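(* The following problem is in NP: given a graph $G$ and an integer $k \le |V(G)|^c$ (where $c$ is a fixed constant), decide whether $G$ admits a Helly $B_k$-EPG representation.
   Context: A grid is the set of integer points of the plane; a grid edge joins two grid points at distance $1$. A path in the grid is a sequence of distinct grid edges in which consecutive edges share exactly one grid point and non-consecutive edges share none; a bend is a pair of consecutive edges of the path with different directions (horizontal/vertical). An EPG representation of a graph $G$ is a family $(P_v)_{v\in V(G)}$ of grid paths such that distinct $u,v$ are adjacent iff $P_u,P_v$ share a grid edge; it is a $B_k$-EPG representation if every path has at most $k$ bends. It is Helly if every subfamily of pairwise edge-intersecting paths has a grid edge common to all its members. *)

(* Defs.v *)
From HB Require Import structures.
From mathcomp Require Import all_boot all_order all_algebra.
Set Implicit Arguments. Unset Strict Implicit. Unset Printing Implicit Defensive.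
Import GRing.Theory Num.Theory.

Definition gpoint := (int * int)%type.

(* A grid edge joins two grid points at distance 1.  We represent it
   canonically by its lower-left endpoint p and its direction
   (true = horizontal: {p, p+(1,0)}, false = vertical: {p, p+(0,1)}).
   This is a bijection with the set of unordered pairs of grid points at
   distance 1. *)
Definition gedge := (gpoint * bool)%type.

Definition edge_dir (e : gedge) : bool := e.2.

Definition edge_ends (e : gedge) : seq gpoint :=
  let: ((x, y), h) := e in
  if h then [:: (x, y); (x + 1, y)%R] else [:: (x, y); (x, y + 1)%R].

Definition common_points (e f : gedge) : seq gpoint :=
  [seq p <- edge_ends e | p \in edge_ends f].

Definition grid_path (s : seq gedge) : Prop :=
  [/\ 0 < size s, uniq s,
      (forall i, i.+1 < size s ->
         size (common_points (nth (0%R, 0%R, true) s i)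
                             (nth (0%R, 0%R, true) s i.+1)) = 1) &
      (forall i j, i.+1 < j -> j < size s ->
         common_points (nth (0%R, 0%R, true) s i)
                       (nth (0%R, 0%R, true) s j) = [::])].

Definition bends (s : seq gedge) : nat :=
  \sum_(i < (size s).-1)
     (edge_dir (nth (0%R, 0%R, true) s i) != edge_dir (nth (0%R, 0%R, true) s i.+1)).

Definition simple_graph (n : nat) (adj : 'I_n -> 'I_n -> bool) : Prop :=
  (forall u v, adj u v = adj v u) /\ (forall u, adj u u = false).

Definition EPG_rep (n : nat) (adj : 'I_n -> 'I_n -> bool)
    (P : 'I_n -> seq gedge) : Prop :=
  (forall v, grid_path (P v)) /\
  (forall u v, u != v -> (adj u v <-> exists e, (e \in P u) && (e \in P v))).

Definition Bk_EPG_rep (k n : nat) adj (P : 'I_n -> seq gedge) : Prop :=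
  EPG_rep adj P /\ forall v, bends (P v) <= k.

Definition Helly_family (n : nat) (P : 'I_n -> seq gedge) : Prop :=
  forall S : {set 'I_n},
    (forall u v, u \in S -> v \in S -> exists e, (e \in P u) && (e \in P v)) ->
    exists e, forall v, v \in S -> e \in P v.

Definition has_Helly_Bk_EPG (k n : nat) (adj : 'I_n -> 'I_n -> bool) : Prop :=
  exists P : 'I_n -> seq gedge, Bk_EPG_rep k adj P /\ Helly_family P.

Inductive move := MoveL | MoveR | Stay.

Record TM := {
  tm_Q : finType;
  tm_G : finType;
  tm_blank : tm_G;
  tm_in : option bool -> tm_G;        (* input symbols: bits and separator *)
  tm_start : tm_Q;
  tm_acc : tm_Q;
  tm_rej : tm_Q;
  tm_delta : tm_Q -> tm_G -> tm_Q * tm_G * move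
}.

(* configuration: state, (cells left of head, nearest first), head cell,
   cells right of head; all other cells are blank *)
Definition config (M : TM) := (tm_Q M * (seq (tm_G M) * tm_G M * seq (tm_G M)))%type.

Definition tm_step (M : TM) (c : config M) : config M :=
  let: (q, (l, a, r)) := c in
  if (q == tm_acc M) || (q == tm_rej M) then c else
  let: (q', b, m) := tm_delta q a in
  match m with
  | MoveL => match l with
             | [::] => (q', ([::], tm_blank M, b :: r))
             | x :: l' => (q', (l', x, b :: r))
             end
  | MoveR => match r with
             | [::] => (q', (b :: l, tm_blank M, [::]))
             | x :: r' => (q', (b :: l, x, r'))
             end
  | Stay => (q', (l, b, r))
  end.

Definition tm_init (M : TM) (w : seq (option bool)) : config M :=
  match w with
  | [::] => (tm_start M, ([::], tm_blank M, [::]))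
  | a :: w' => (tm_start M, ([::], tm_in M a, map (tm_in M) w'))
  end.

(* M accepts w within t steps (halting states are absorbing) *)
Definition accepts_within (M : TM) (w : seq (option bool)) (t : nat) : bool :=
  (iter t (@tm_step M) (tm_init M w)).1 == tm_acc M.

Definition pair_input (x y : seq bool) : seq (option bool) :=
  map Some x ++ None :: map Some y.

Definition in_NP (L : seq bool -> Prop) : Prop :=
  exists (M : TM) (a b : nat), forall x : seq bool,
    L x <-> exists y : seq bool,
      size y <= a * (size x).+1 ^ b /\
      accepts_within M (pair_input x y) (a * (size x).+1 ^ b).

(* canonical binary representation of k, least significant bit first,
   no trailing zero ([::] for 0) *)
Definition bin (k : nat) : seq bool :=
  if k == 0 then [::] else [seq odd (k %/ 2 ^ i) | i <- iota 0 (trunc_log 2 k).+1].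

Definition encode (n : nat) (adj : 'I_n -> 'I_n -> bool) (k : nat) : seq bool :=
  nseq n true ++ false :: [seq adj i j | i <- enum 'I_n, j <- enum 'I_n] ++ bin k.

Definition HellyBkEPG_lang (c : nat) (w : seq bool) : Prop :=
  exists (n : nat) (adj : 'I_n -> 'I_n -> bool) (k : nat),
    [/\ w = encode adj k, simple_graph adj, k <= n ^ c & has_Helly_Bk_EPG k adj].

(* Main.v *)
Require Import Defs.
From mathcomp Require Import all_boot all_order all_algebra.
From mathcomp Require Import zify.
From Stdlib Require Import FunctionalExtensionality.
Set Implicit Arguments. Unset Strict Implicit. Unset Printing Implicit Defensive.
Import Order.TTheory GRing.Theory Num.Theory.

(* A certificate for (G, k) is a bit table listing, edge by edge, the paths of a
   Helly representation drawn in a grid of polynomial size.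

   Such a grid exists: a column that contains no vertical edge and no end of a
   path is crossed straight by the paths, so it can be contracted. A path with
   k bends has its ends and vertical edges on at most k + 3 columns, hence
   n (k + 3) columns suffice, and symmetrically for rows. The Helly property quantifies
   over exponentially many subfamilies, but by Gilmore's criterion it is enough
   to look, for any three edges, at the paths through at least two of them.

   Hence validity of a certificate is a first-order property of the positions
   of the word "input # certificate", once a least-successor iteration operator
   supplies (saturating) addition, multiplication and halving. A formula of this
   kind is evaluated by a two-way automaton with finitely many heads. A halting
   run of the automaton repeats no configuration, so its length is polynomial,
   and a one-tape machine simulates each step by a sweep over a tape whose cells
   record the heads standing on them. *)

(** Writing the verifier directly as a one-tape machine would mean proving and timing each of its
    loops. Formulas over positions avoid this: their meaning is compositional, and one time bound
    serves them all. The price is that numbers are positions, so nothing beyond the length of the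
    word can be named. Hence the saturation; the table of an actual representation makes the word
    long enough for every number that matters to stay below the cut.

    The formula guesses [n], [k], the radix of the table and the place of the separator by
    existential quantifiers and merely confirms them. A table that passes the checks describes a
    representation whatever its radix, so size estimates belong to completeness alone.

    A table lists single edges, so its size is governed by the value of [k] and not by the number of
    its digits; this is where [k <= n ^ c] keeps it polynomial. In [k + 3], two columns are those of
    the ends of the path and one is that of a vertical run existing before any bend. *)

(** * Multi-head automata given by structured programs *)

(* [inl] is an input letter, [inr true] and [inr false] are the two end markers. *)
Definition sym := (option bool + bool)%type.
Definition lend : sym := inr true.
Definition rend : sym := inr false.

Section Programs.
Variable H : nat.
Notation head := 'I_H.+1.

Inductive prog :=
| PRet of bool
| PMove of head & bool
| PSym of head & sym
| PEq of head & head
| PIf of prog & prog & prog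
| PWhile of prog.

Fixpoint pstate (p : prog) : finType :=
  match p with
  | PIf p q r => (pstate p + (pstate q + pstate r))%type
  | PWhile p => pstate p
  | _ => unit
  end.

Fixpoint pentry (p : prog) : pstate p :=
  match p with
  | PIf p q r => inl (pentry p)
  | PWhile p => pentry p
  | _ => tt
  end.

(** A state reads and moves a single head, so that one step can be simulated by visiting one cell
    and a neighbour of it. *)
Fixpoint phead (p : prog) : pstate p -> head :=
  match p with
  | PIf p q r => fun s => match s with
      | inl s => phead s | inr (inl s) => phead s | inr (inr s) => phead s end
  | PWhile p => @phead p
  | PMove i _ | PSym i _ | PEq i _ => fun _ => i
  | PRet _ => fun _ => ord0
  end.

Definition if_exit (p q r : prog) (s : pstate p + bool) : pstate (PIf p q r) + bool :=
  match s with
  | inl s => inl (inl s)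
  | inr true => inl (inr (inl (pentry q)))
  | inr false => inl (inr (inr (pentry r)))
  end.
Definition then_exit (p q r : prog) (s : pstate q + bool) : pstate (PIf p q r) + bool :=
  match s with inl s => inl (inr (inl s)) | inr b => inr b end.
Definition else_exit (p q r : prog) (s : pstate r + bool) : pstate (PIf p q r) + bool :=
  match s with inl s => inl (inr (inr s)) | inr b => inr b end.
Definition while_exit (p : prog) (s : pstate p + bool) : pstate (PWhile p) + bool :=
  match s with
  | inl s => inl s | inr true => inl (pentry p) | inr false => inr true
  end.

Fixpoint pact (p : prog) : pstate p -> sym -> {set head} -> move * (pstate p + bool) :=
  match p with
  | PRet b => fun _ _ _ => (Stay, inr b)
  | PMove _ b => fun _ _ _ => (if b then MoveR else MoveL, inr true)
  | PSym _ a => fun _ x _ => (Stay, inr (x == a))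
  | PEq _ j => fun _ _ S => (Stay, inr (j \in S))
  | PIf p q r => fun s x S => match s with
      | inl s => let: (m, t) := pact s x S in (m, if_exit q r t)
      | inr (inl s) => let: (m, t) := pact s x S in (m, then_exit p r t)
      | inr (inr s) => let: (m, t) := pact s x S in (m, else_exit p q t)
      end
  | PWhile p => fun s x S => let: (m, t) := @pact p s x S in (m, while_exit t)
  end.

Variable w : seq (option bool).
Notation pos := 'I_(size w).+2.
Notation heads := {ffun head -> pos}.

Definition letter (p : nat) : sym := nth rend (lend :: map inl w) p.

Definition marks (h : heads) (p : nat) : {set head} := [set i | h i == p :> nat].

Definition shift (m : move) (p : pos) : pos :=
  match m with
  | MoveL => inord p.-1
  | MoveR => inord (minn p.+1 (size w).+1)
  | Stay => p
  end.

Definition set_head (h : heads) (i : head) (x : pos) : heads :=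
  [ffun j => if j == i then x else h j].

Definition pstep (p : prog) (c : (pstate p + bool) * heads) : (pstate p + bool) * heads :=
  match c.1 with
  | inr b => c
  | inl s => let i := phead s in
      let: (m, t) := pact s (letter (c.2 i)) (marks c.2 (c.2 i)) in
      (t, set_head c.2 i (shift m (c.2 i)))
  end.

Inductive exec : prog -> heads -> bool -> heads -> Prop :=
| exec_ret b h : exec (PRet b) h b h
| exec_move i b h :
    exec (PMove i b) h true (set_head h i (shift (if b then MoveR else MoveL) (h i)))
| exec_sym i a h : exec (PSym i a) h (letter (h i) == a) h
| exec_eq i j h : exec (PEq i j) h (h i == h j) h
| exec_if p q r h b h1 b' h2 : exec p h b h1 -> exec (if b then q else r) h1 b' h2 ->
    exec (PIf p q r) h b' h2
| exec_stop p h h' : exec p h false h' -> exec (PWhile p) h true h'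
| exec_loop p h h1 b h2 : exec p h true h1 -> exec (PWhile p) h1 b h2 ->
    exec (PWhile p) h b h2.

Lemma set_head_id h i : set_head h i (h i) = h.
Proof. by apply/ffunP => j; rewrite ffunE; case: eqP => [->|]. Qed.

(** [f] may send an exit of [p] to an entry state inside [q], which is how subprograms are chained.
    Commutation is asked only for running states, since a halted [p] stands still while [q] goes
    on. *)
Lemma embed_run (p q : prog) (f : pstate p + bool -> pstate q + bool) :
  (forall s h, pstep (f (inl s), h) =
     (f (pstep (inl s, h)).1, (pstep (p:=p) (inl s, h)).2)) ->
  forall m s h b h', iter m (@pstep p) (inl s, h) = (inr b, h') ->
  exists m', iter m' (@pstep q) (f (inl s), h) = (f (inr b), h').
Proof.
move=> fP; elim=> [|m IH] s h b h' //; rewrite iterSr.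
have := fP s h; case: (pstep (inl s, h)) => -[s1|b1] h1 /= E.
  by case/IH => m' <-; exists m'.+1; rewrite iterSr E.
have -> : iter m (@pstep p) (inr b1, h1) = (inr b1, h1) by elim: m {IH} => //= m ->.
by case=> <- <-; exists 1.
Qed.

Lemma exec_run p h b h' : exec p h b h' ->
  exists m, iter m (@pstep p) (inl (pentry p), h) = (inr b, h').
Proof.
elim=> {p h b h'}.
- by move=> b h; exists 1; rewrite /= /pstep /= set_head_id.
- by move=> i b h; exists 1; rewrite /= /pstep /=.
- by move=> i a h; exists 1; rewrite /= /pstep /= set_head_id.
- by move=> i j h; exists 1; rewrite /= /pstep /= set_head_id inE eq_sym.
- move=> p q r h b h1 b' h2 _ [m1 E1] _ [m2 E2].
  have [s h0|m1' E1'] := embed_run (f := @if_exit p q r) _ E1.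
    by rewrite /pstep /=; case: (pact _ _ _).
  suff [m2' E2']: exists m, iter m (@pstep (PIf p q r)) (if_exit q r (inr b), h1) = (inr b', h2).
    by exists (m2' + m1'); rewrite iterD E1'.
  case: b E1 E2 E1' => E1 E2 E1' /=.
    have [s h0|m2' E2'] := embed_run (f := @then_exit p q r) _ E2; last by exists m2'.
    by rewrite /pstep /=; case: (pact _ _ _).
  have [s h0|m2' E2'] := embed_run (f := @else_exit p q r) _ E2; last by exists m2'.
  by rewrite /pstep /=; case: (pact _ _ _).
- move=> p h h' _ [m E].
  have [s h0|m' E'] := embed_run (f := @while_exit p) _ E; last by exists m'.
  by rewrite /pstep /=; case: (pact _ _ _).
- move=> p h h1 b h2 _ [m E] _ [m2 E2].
  have [s h0|m' E'] := embed_run (f := @while_exit p) _ E.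
    by rewrite /pstep /=; case: (pact _ _ _).
  by exists (m2 + m'); rewrite iterD E'.
Qed.

(* A run reaching a halted configuration visits no configuration twice. *)
Lemma exec_bounded_run p h b h' : exec p h b h' ->
  exists2 m, m <= #|{: pstate p + bool}| * (size w).+2 ^ H.+1 &
    iter m (@pstep p) (inl (pentry p), h) = (inr b, h').
Proof.
move=> /exec_run [m E].
set x := (_, h) in E; set y := (_, h') in E.
have xy : fconnect (@pstep p) x y by rewrite -E fconnect_iter.
exists (findex (@pstep p) x y); last exact: iter_findex.
apply: leq_trans (ltnW (findex_max xy)) _.
apply: leq_trans (max_card _) _.
by rewrite card_prod card_ffun !card_ord.
Qed.

End Programs.

(** * Simulation on a one-tape machine *)

Local Arguments tm_step : simpl never.

Section Simulation.
Variables (H : nat) (p : prog H).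
Notation head := 'I_H.+1.
Notation exitst := (pstate p + bool)%type.

(* A cell carries an input letter or end marker and the set of heads standing
   on it; the blank symbol doubles as the right end marker. *)
Definition cell : finType := (sym * {set head})%type.

(* An automaton step [s] runs through [s_seek s], which looks for the head to
   be read, [s_put], which sets it down on a neighbouring cell, and [s_rewind]. *)
Definition sstate : finType :=
  ((option bool + bool) + (pstate p + (exitst * head + exitst)))%type.
Definition s_init : sstate := inl (inl None).
Definition s_mark : sstate := inl (inl (Some true)).
Definition s_walk : sstate := inl (inl (Some false)).
Definition s_halt (b : bool) : sstate := inl (inr b).
Definition s_seek (s : pstate p) : sstate := inr (inl s).
Definition s_put (t : exitst) (i : head) : sstate := inr (inr (inl (t, i))).
Definition s_rewind (t : exitst) : sstate := inr (inr (inr t)).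

Definition s_next (t : exitst) : sstate :=
  match t with inl s => s_seek s | inr b => s_halt b end.

(** The machine knows its place only by the end markers. These are exactly the positions where
    [shift] truncates a move, and there the head is left where it stands. *)
Definition clamp (x : sym) (m : move) : move :=
  match m with
  | MoveL => if x == lend then Stay else MoveL
  | MoveR => if x == rend then Stay else MoveR
  | Stay => Stay
  end.

(** The machine starts on the first input letter. It writes the left marker, bearing all heads, on
    the cell before, then walks once to the right marker: this brings the tape to its final length,
    so later sweeps never leave the cells already listed. *)
Definition sdelta (q : sstate) (c : cell) : sstate * cell * move :=
  match q with
  | inl (inl None) => (s_mark, c, MoveL)
  | inl (inl (Some true)) => (s_walk, (lend, setT), MoveR)
  | inl (inl (Some false)) =>
      if c.1 == rend then (s_rewind (inl (pentry p)), c, Stay) else (s_walk, c, MoveR)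
  | inl (inr b) => (q, c, Stay)
  | inr (inl s) =>
      if phead s \in c.2 then
        let: (m, t) := pact s c.1 c.2 in
        match clamp c.1 m with
        | Stay => (s_rewind t, c, Stay)
        | m => (s_put t (phead s), (c.1, c.2 :\ phead s), m)
        end
      else (q, c, MoveR)
  | inr (inr (inl (t, i))) => (s_rewind t, (c.1, i |: c.2), Stay)
  | inr (inr (inr t)) =>
      if c.1 == lend then (s_next t, c, Stay) else (q, c, MoveL)
  end.

Definition simulator : TM := {|
  tm_Q := sstate; tm_G := cell; tm_blank := (rend, set0);
  tm_in := fun a => (inl a, set0);
  tm_start := s_init; tm_acc := s_halt true; tm_rej := s_halt false;
  tm_delta := sdelta |}.

Definition tape_config (L : nat) (q : sstate) (c : nat -> cell) (i : nat) : config simulator :=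
  (q, ([seq c j | j <- rev (iota 0 i)], c i, [seq c j | j <- iota i.+1 (L - i)])).

Definition write (c : nat -> cell) (i : nat) (a : cell) : nat -> cell :=
  fun j => if j == i then a else c j.

Lemma tape_config_ext L q c c' i : c =1 c' -> tape_config L q c i = tape_config L q c' i.
Proof.
by move=> e; rewrite /tape_config e; congr (_, (_, _, _)); apply: eq_map.
Qed.

Definition halted (q : sstate) := if q is inl (inr _) then true else false.

Lemma halted_halt q : ((q == s_halt true) || (q == s_halt false)) = halted q.
Proof. by case: q => [[|[]]|]. Qed.

Lemma rev_iotaS i : rev (iota 0 i.+1) = i :: rev (iota 0 i).
Proof. by rewrite -addn1 iotaD rev_cat. Qed.

Lemma step_tape L q c i q' b m : ~~ halted q -> sdelta q (c i) = (q', b, m) ->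
  i <= L -> match m with MoveL => 0 < i | MoveR => i < L | Stay => true end ->
  tm_step (tape_config L q c i) =
  tape_config L q' (write c i b) (match m with MoveL => i.-1 | MoveR => i.+1 | Stay => i end).
Proof.
move=> nh E iL; rewrite /tm_step /tape_config [X in if X then _ else _]halted_halt (negbTE nh).
rewrite [tm_delta _ _]E.
have lw : [seq write c i b j | j <- rev (iota 0 i)] = [seq c j | j <- rev (iota 0 i)].
  apply/eq_in_map => j; rewrite mem_rev mem_iota /write => /andP[_ ji].
  by rewrite ltn_eqF.
have rw : [seq write c i b j | j <- iota i.+1 (L - i)] = [seq c j | j <- iota i.+1 (L - i)].
  by apply/eq_in_map => j; rewrite mem_iota /write => /andP[ji _]; rewrite gtn_eqF.
have cw : write c i b i = b by rewrite /write eqxx.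
case: m {E} => Hm.
- case: i Hm iL lw rw cw => // i _ iL lw rw cw; rewrite -lw -rw.
  rewrite rev_iotaS /=.
  by rewrite -(subnSK iL) /= cw.
- by move: rw; rewrite rev_iotaS -(subnSK Hm) /= lw cw => -[-> ->].
- by rewrite -lw -rw cw.
Qed.

Lemma write_id c i : write c i (c i) =1 c.
Proof. by move=> j; rewrite /write; case: eqP => // ->. Qed.

Lemma step_tape_read L q c i q' m : ~~ halted q -> sdelta q (c i) = (q', c i, m) ->
  i <= L -> match m with MoveL => 0 < i | MoveR => i < L | Stay => true end ->
  tm_step (tape_config L q c i) =
  tape_config L q' c (match m with MoveL => i.-1 | MoveR => i.+1 | Stay => i end).
Proof.
move=> nh E iL Hm; rewrite (step_tape nh E iL Hm).
by apply/tape_config_ext/write_id.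
Qed.

Variable w : seq (option bool).
Notation N := (size w).
Notation pos := 'I_N.+2.
Notation heads := {ffun head -> pos}.

Definition heads_cell (h : heads) (i : nat) : cell := (letter w i, marks h i).

Lemma letter_lend i : (letter w i == lend) = (i == 0).
Proof.
case: i => [|i]; first by rewrite eqxx.
rewrite /letter /=; case: (ltnP i (size w)) => iw.
  by rewrite (nth_map None).
by rewrite nth_default // size_map.
Qed.

Lemma letter_rend i : (letter w i == rend) = (N < i).
Proof.
case: i => [|i] //; rewrite /letter /= ltnS; case: (ltnP i (size w)) => iw.
  by rewrite (nth_map None).
by rewrite nth_default ?eqxx // size_map.
Qed.

Lemma rewind_run (h : heads) t i : i <= N.+1 ->
  iter i.+1 (@tm_step simulator) (tape_config N.+1 (s_rewind t) (heads_cell h) i) =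
  tape_config N.+1 (s_next t) (heads_cell h) 0.
Proof.
elim: i => [|i IH] iN; rewrite iterSr.
  by rewrite (@step_tape_read _ _ _ _ (s_next t) Stay) //= letter_lend.
by rewrite (@step_tape_read _ _ _ _ (s_rewind t) MoveL) ?(IH (ltnW iN)) //= letter_lend.
Qed.

Lemma seek_run (h : heads) s i : i <= h (phead s) ->
  iter i (@tm_step simulator) (tape_config N.+1 (s_seek s) (heads_cell h) 0) =
  tape_config N.+1 (s_seek s) (heads_cell h) i.
Proof.
elim: i => [|i IH] iN //=.
have iN' : i < N.+1 by have := ltn_ord (h (phead s)); lia.
rewrite IH 1?ltnW // (@step_tape_read _ _ _ _ (s_seek s) MoveR) //= 1?ltnW //.
by rewrite inE gtn_eqF.
Qed.

Lemma simulate_step (s : pstate p) (h : heads) t (h' : heads) : pstep (inl s, h) = (t, h') ->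
  exists2 m, m <= (2 * N + 6) &
   iter m (@tm_step simulator) (tape_config N.+1 (s_seek s) (heads_cell h) 0) =
   tape_config N.+1 (s_next t) (heads_cell h') 0.
Proof.
rewrite /pstep /=; set i := h (phead s).
case E: (pact _ _ _) => [m t'] [? <-]; subst t'.
have iN : i <= N.+1 by rewrite -ltnS ltn_ord.
have Hs := seek_run (leqnn i).
have Hin : phead s \in marks h i by rewrite inE.
case Em: (clamp (letter w i) m) => [||].
- have [mL i0] : m = MoveL /\ 0 < i.
    by move: Em; case: (m) => //=; [rewrite letter_lend|case: ifP]; case: (posnP i).
  have iN1 : i.-1 <= N.+1 by lia.
  (* From the right: [i] steps of seeking, two that lift the head and set it down, and the rewind
     from the new cell. *)
  exists (i.-1.+1 + 2 + i); first lia.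
  rewrite !iterD Hs /= (@step_tape _ _ _ _ (s_put t (phead s))
    (letter w i, marks h i :\ phead s) MoveL) //=; last by rewrite Hin E Em.
  rewrite (@step_tape _ _ _ _ (s_rewind t)
    (letter w i.-1, phead s |: marks h i.-1) Stay) //=; last first.
    by rewrite /write ltn_eqF //; lia.
  rewrite -iterS -(rewind_run _ _ iN1); congr (iter _ _ _).
  apply: tape_config_ext => j; rewrite /write /heads_cell mL /=.
  case: eqP => [->|/eqP ji'].
    congr (_, _); apply/setP => k; rewrite !inE ffunE; case: (k =P phead s) => //= _.
    by rewrite inordK ?eqxx //; lia.
  case: eqP => [->|/eqP ji].
    congr (_, _); apply/setP => k; rewrite !inE ffunE; case: (k =P phead s) => //= _.
    by rewrite inordK; lia.
  congr (_, _); apply/setP => k; rewrite !inE ffunE; case: (k =P phead s) => //= ->.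
  by rewrite -/i inordK; lia.
- have [mR i0] : m = MoveR /\ i < N.+1.
    move: Em; case: (m) => //=; first by case: ifP.
    by rewrite letter_rend; case: (ltnP N i).
  exists (i.+2 + 2 + i); first lia.
  rewrite !iterD Hs /= (@step_tape _ _ _ _ (s_put t (phead s))
    (letter w i, marks h i :\ phead s) MoveR) //=; last by rewrite Hin E Em.
  rewrite (@step_tape _ _ _ _ (s_rewind t)
    (letter w i.+1, phead s |: marks h i.+1) Stay) //=; last first.
    by rewrite /write gtn_eqF.
  rewrite -!iterS -(rewind_run _ _ i0); congr (iter _ _ _).
  apply: tape_config_ext => j; rewrite /write /heads_cell mR /=.
  have -> : minn i.+1 N.+1 = i.+1 by lia.
  case: eqP => [->|/eqP ji'].
    congr (_, _); apply/setP => k; rewrite !inE ffunE; case: (k =P phead s) => //= _.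
    by rewrite inordK ?eqxx.
  case: eqP => [->|/eqP ji].
    congr (_, _); apply/setP => k; rewrite !inE ffunE; case: (k =P phead s) => //= _.
    by rewrite inordK //; lia.
  congr (_, _); apply/setP => k; rewrite !inE ffunE; case: (k =P phead s) => //= ->.
  by rewrite -/i inordK //; lia.
- have hE : set_head h (phead s) (shift m i) = h.
    have -> : shift m i = i; last by rewrite /i set_head_id.
    apply: val_inj; move: Em; case: (m) => //=.
      by rewrite letter_lend; case: eqP => // -> _; rewrite inordK.
    rewrite letter_rend; case: ifP => // Ni _; rewrite inordK; lia.
  exists (i.+1 + 1 + i); first lia.
  rewrite hE !iterD Hs -(rewind_run _ _ iN); congr (iter _ _ _).
  by rewrite /= (@step_tape_read _ _ _ _ (s_rewind t) Stay) //= Hin E Em.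
Qed.

Definition heads0 : heads := [ffun=> ord0].

Lemma marks0 i : marks heads0 i = if i == 0 then setT else set0.
Proof. by apply/setP => j; rewrite inE ffunE eq_sym; case: i => [|i]; rewrite inE. Qed.

Lemma simulate_init : 0 < N ->
  iter (2 * N + 5) (@tm_step simulator) (tm_init simulator w) =
  tape_config N.+1 (s_seek (pentry p)) (heads_cell heads0) 0.
Proof.
(* From the right: two steps to place the left marker, the walk to the last letter, one step onto
   the blank beyond it, one to recognise it, and the rewind. *)
move=> N0; have -> : 2 * N + 5 = N.+2 + 1 + 1 + N.-1 + 2 by lia.
rewrite !iterD.
have -> : iter 2 (@tm_step simulator) (tm_init simulator w) =
   tape_config N s_walk (heads_cell heads0) 1.
  have -> : tm_init simulator w =
      (s_init, ([::], (inl (nth None w 0), set0), [seq (inl a, set0) | a <- behead w])).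
    by case: (w) N0.
  rewrite /= /tm_step /= /tape_config /heads_cell /= !marks0 /=; congr (_, (_, _, _)).
    by rewrite /letter /= (nth_map None).
  apply: (@eq_from_nth _ (rend, set0)); rewrite !size_map size_behead.
    by rewrite size_iota subn1.
  move=> i iw; rewrite (nth_map None) ?size_behead // nth_behead.
  rewrite -subn1 in iw.
  rewrite (nth_map 0) ?size_iota // nth_iota // marks0 /= /letter /= add1n.
  by rewrite (nth_map None) //; lia.
have walk i : 0 < i <= N -> iter i.-1 (@tm_step simulator)
    (tape_config N s_walk (heads_cell heads0) 1) = tape_config N s_walk (heads_cell heads0) i.
  elim: i => // i IH /andP[_ iN]; case: (posnP i) => [->//|i0] /=.
  rewrite -(prednK i0) /= IH ?i0 1?ltnW // (@step_tape_read _ _ _ _ s_walk MoveR) //= 1?ltnW //.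
    by rewrite prednK.
  by rewrite letter_rend ltnNge ltnW.
rewrite walk ?N0 //=.
have -> : tm_step (tape_config N s_walk (heads_cell heads0) N) =
   tape_config N.+1 s_walk (heads_cell heads0) N.+1.
  rewrite /tm_step /tape_config /= letter_rend ltnn !subnn /=.
  congr (_, (_, _, _)).
    by rewrite rev_iotaS.
  by rewrite /heads_cell marks0 (eqP (_ : letter w N.+1 == rend)) // letter_rend.
rewrite (@step_tape_read _ _ _ _ (s_rewind (inl (pentry p))) Stay) //=; last first.
  by rewrite letter_rend ltnSn.
by rewrite -!iterS rewind_run.
Qed.

Lemma simulate_run m : exists2 t, t <= m * (2 * N + 6) &
  let c := iter m (@pstep _ w p) (inl (pentry p), heads0) in
  iter t (@tm_step simulator) (tape_config N.+1 (s_seek (pentry p)) (heads_cell heads0) 0) =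
  tape_config N.+1 (s_next c.1) (heads_cell c.2) 0.
Proof.
elim: m => [|m [t tm E]]; first by exists 0.
rewrite /= in E *; case Ec: (iter m _ _) E => [s h] E.
case: s Ec E => [s|b] Ec E; last first.
  by exists t; [rewrite mulSn (leq_trans tm) ?leq_addl | exact: E].
case Es: (pstep (inl s, h)) => [s' h'].
have [t' tm' E'] := simulate_step Es.
by exists (t' + t); [rewrite mulSn leq_add | rewrite iterD E E'].
Qed.

Lemma halt_absorbing c t : halted c.1 -> iter t (@tm_step simulator) c = c.
Proof.
case: c => q [[l a] r] /= hq; elim: t => //= t ->.
by rewrite /tm_step [X in if X then _ else _]halted_halt hq.
Qed.

(** Halting is absorbing, so two halted configurations of the same run coincide; acceptance after
    any number of steps therefore forces [b], and only the converse needs a time bound. The extra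
    [.+1] in that bound pays for the set-up phase. *)
Lemma simulator_decides b h : 0 < N -> exec p heads0 b h ->
  forall t, (accepts_within simulator w t -> b) /\
   (b -> (#|{: pstate p + bool}| * N.+2 ^ H.+1).+1 * (2 * N + 6) <= t ->
     accepts_within simulator w t).
Proof.
move=> N0 /exec_bounded_run [m mB E] t.
have [t' t'm] := simulate_run m; rewrite E /= -simulate_init // -iterD.
set T := t' + _ => ET.
split=> [|bt Bt].
  rewrite /accepts_within => acc.
  have hal : halted (iter t (@tm_step simulator) (tm_init simulator w)).1 by rewrite (eqP acc).
  have := halt_absorbing (T) hal; rewrite -iterD addnC iterD ET halt_absorbing //.
  by move=> Eq; move: acc; rewrite -Eq; case: (b).
have Tt : T <= t.
  apply: leq_trans Bt; rewrite /T mulSn addnC leq_add //; first lia.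
  by apply: leq_trans t'm _; rewrite leq_mul2r mB orbT.
rewrite /accepts_within -(subnK Tt) iterD ET halt_absorbing //.
by rewrite bt.
Qed.

End Simulation.

(** * Formulas over word positions *)

(* [FIter x y f a m b]: starting from [a] and replacing [m] times the current
   value [x] by the least [y] such that [f], one arrives at [b].
   [FSub f g] is [f] with every free variable [x] renamed into [g x]. *)
Inductive form :=
| FSym of sym & nat
| FEq of nat & nat
| FSucc of nat & nat
| FNot of form
| FAnd of form & form
| FEx of nat & form
| FIter of nat & nat & form & nat & nat & nat
| FSub of form & (nat -> nat).

Definition upd (T : Type) (e : nat -> T) (x : nat) (v : T) : nat -> T :=
  fun y => if y == x then v else e y.

(* The last position [n] when [P] does not hold earlier. *)
Definition first_pos (n : nat) (P : pred 'I_n.+1) : 'I_n.+1 :=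
  inord (find (fun k => P (inord k)) (iota 0 n)).

Fixpoint eval (w : seq (option bool)) (f : form) (e : nat -> 'I_(size w).+2) : bool :=
  match f with
  | FSym a x => letter w (e x) == a
  | FEq x y => e x == e y
  | FSucc x y => (e x).+1 == e y :> nat
  | FNot f => ~~ eval f e
  | FAnd f g => eval f e && eval g e
  | FEx x f => [exists v, eval f (upd e x v)]
  | FIter x y f a m b =>
      iter (e m) (fun v => first_pos (fun u => eval f (upd (upd e x v) y u))) (e a) == e b
  | FSub f g => eval f (fun x => e (g x))
  end.

Lemma eval_ext w f (e e' : nat -> 'I_(size w).+2) : e =1 e' -> eval f e = eval f e'.
Proof.
have ext_upd x v (e1 e2 : nat -> 'I_(size w).+2) : e1 =1 e2 -> upd e1 x v =1 upd e2 x v.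
  by move=> E y; rewrite /upd E.
elim: f e e' => /=.
- by move=> a x e e' E; rewrite E.
- by move=> x y e e' E; rewrite !E.
- by move=> x y e e' E; rewrite !E.
- by move=> f IH e e' E; rewrite (IH _ _ E).
- by move=> f IHf g IHg e e' E; rewrite (IHf _ _ E) (IHg _ _ E).
- by move=> x f IH e e' E; apply: eq_existsb => v; apply/IH/ext_upd.
- move=> x y f IH a m b e e' E; rewrite !E; congr (_ == _).
  apply: eq_iter => v; congr inord; apply: eq_find => u.
  by apply/IH/ext_upd/ext_upd.
- by move=> f IH g e e' E; apply: IH => x.
Qed.

(** How many scratch heads [compile] uses. Conjuncts share them, since a finished subprogram leaves
    nothing of value on its own. *)
Fixpoint width (f : form) : nat :=
  match f with
  | FSym _ _ | FEq _ _ => 0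
  | FSucc _ _ => 1
  | FNot f | FSub f _ => width f
  | FAnd f g => maxn (width f) (width g)
  | FEx _ f => (width f).+1
  | FIter _ _ f _ _ _ => (width f).+3
  end.

(** * Compiling formulas into automaton programs *)

Section Compile.
Variable H : nat.
Notation head := 'I_H.+1.
Implicit Types (p q r : prog H) (i j k : head).

Definition PSeq p q : prog H := PIf p q q.
Definition PReset k : prog H := PWhile (PIf (PSym k lend) (PRet H false) (PMove k false)).
Definition PCopy k i : prog H :=
  PSeq (PReset k) (PWhile (PIf (PEq k i) (PRet H false) (PMove k true))).
Definition PSearch k p : prog H :=
  PSeq (PReset k)
    (PWhile (PIf p (PRet H false) (PIf (PSym k rend) (PRet H false) (PMove k true)))).

(* Variable [x] lives on head [rho x]; the heads from [d] on are scratch. *)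
Fixpoint compile (f : form) (rho : nat -> head) (d : nat) : prog H :=
  match f with
  | FSym a x => PSym (rho x) a
  | FEq x y => PEq (rho x) (rho y)
  | FSucc x y =>
      let k := inord d in
      PIf (PSym (rho y) lend) (PRet H false)
        (PSeq (PCopy k (rho y)) (PSeq (PMove k false) (PEq k (rho x))))
  | FNot f => PIf (compile f rho d) (PRet H false) (PRet H true)
  | FAnd f g => PIf (compile f rho d) (compile g rho d) (PRet H false)
  | FEx x f =>
      let p := compile f (upd rho x (inord d)) d.+1 in PSeq (PSearch (inord d) p) p
  | FIter x y f a m b =>
      let c := inord d in let n := inord d.+1 in let t := inord d.+2 in
      let p := compile f (upd (upd rho x c) y t) d.+3 in
      PSeq (PCopy c (rho a)) (PSeq (PReset n) (PSeq
        (PWhile (PIf (PEq n (rho m)) (PRet H false)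
           (PSeq (PSearch t p) (PSeq (PCopy c t) (PMove n true)))))
        (PEq c (rho b))))
  | FSub f g => compile f (fun x => rho (g x)) d
  end.

Variable w : seq (option bool).
Notation N := (size w).
Notation pos := 'I_N.+2.
Notation heads := {ffun head -> pos}.
Implicit Types h : heads.

Definition agree (d : nat) h h' := forall i, i < d -> h' i = h i.

Lemma agree_trans d h1 h2 h3 : agree d h1 h2 -> agree d h2 h3 -> agree d h1 h3.
Proof. by move=> a b i id; rewrite b // a. Qed.

Lemma agree_leq d d' h h' : d <= d' -> agree d' h h' -> agree d h h'.
Proof. by move=> dd' a i id; apply: a; apply: leq_trans dd'. Qed.

Lemma agree_set d h k v : d <= k -> agree d h (set_head h k v).
Proof. by move=> dk i id; rewrite ffunE; case: eqP id dk => // ->; lia. Qed.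

Lemma set_head_same h k v : set_head h k v k = v.
Proof. by rewrite ffunE eqxx. Qed.

Lemma set_head_twice h k v v' : set_head (set_head h k v) k v' = set_head h k v'.
Proof. by apply/ffunP => i; rewrite !ffunE; case: eqP. Qed.

Lemma exec_ifT p q r h h1 b h2 :
  exec p h true h1 -> exec q h1 b h2 -> exec (PIf p q r) h b h2.
Proof. exact: exec_if. Qed.

Lemma exec_ifF p q r h h1 b h2 :
  exec p h false h1 -> exec r h1 b h2 -> exec (PIf p q r) h b h2.
Proof. exact: exec_if. Qed.

Lemma exec_seq p q h b h1 b' h2 : exec p h b h1 -> exec q h1 b' h2 -> exec (PSeq p q) h b' h2.
Proof. by move=> e1 e2; apply: exec_if e1 _; case: b. Qed.

Lemma exec_sym_eq k a h b : (letter w (h k) == a) = b -> exec (PSym k a) h b h.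
Proof. by move=> <-; apply: exec_sym. Qed.

Lemma exec_eq_eq k i h b : (h k == h i) = b -> exec (PEq k i) h b h.
Proof. by move=> <-; apply: exec_eq. Qed.

Lemma exec_reset k h : exec (PReset k) h true (set_head h k ord0).
Proof.
move Em: (h k : nat) => m; elim: m h Em => [|m IH] h Em.
  have E0 : h k = ord0 by apply: val_inj.
  rewrite -E0 set_head_id; apply: exec_stop; apply: exec_ifT (exec_ret _ _).
  by apply: exec_sym_eq; rewrite letter_lend Em.
apply: exec_loop; first by apply: exec_ifF (exec_move _ _ _); apply: exec_sym_eq; rewrite letter_lend Em.
rewrite -(set_head_twice h k (shift MoveL (h k)) ord0); apply: IH.
by rewrite set_head_same /= Em inordK //=; have := ltn_ord (h k); lia.
Qed.

Lemma exec_copy k i h : k != i -> exec (PCopy k i) h true (set_head h k (h i)).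
Proof.
move=> ki; apply: exec_seq (exec_reset _ _) _.
set h0 := set_head h k ord0.
have -> : set_head h k (h i) = set_head h0 k (h0 i).
  by rewrite set_head_twice /h0 ffunE eq_sym (negbTE ki).
have : h0 k <= h0 i by rewrite /h0 set_head_same.
move Em: (h0 i - h0 k) => m; move: h0 Em => {}h; elim: m h => [|m IH] h Em le.
  have E0 : h k = h i by apply: val_inj => /=; lia.
  rewrite -E0 set_head_id; apply: exec_stop; apply: exec_ifT (exec_ret _ _).
  by apply: exec_eq_eq; rewrite E0 eqxx.
apply: exec_loop.
  apply: exec_ifF (exec_move _ _ _); apply: exec_eq_eq.
  by apply/eqP => E; rewrite E in Em; lia.
set h1 := set_head _ _ _.
have -> : set_head h k (h i) = set_head h1 k (h1 i).
  by rewrite set_head_twice /h1 ffunE eq_sym (negbTE ki).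
have iN := ltn_ord (h i).
have E1 : h1 k = (h k).+1 :> nat by rewrite set_head_same /= inordK; lia.
have E2 : h1 i = h i by rewrite /h1 ffunE eq_sym (negbTE ki).
by apply: IH; rewrite E1 E2; lia.
Qed.

Lemma exec_search k p h (P : pred pos) :
  (forall h1, agree k h h1 -> exists2 h2, exec p h1 (P (h1 k)) h2 & agree k.+1 h1 h2) ->
  exists2 h', exec (PSearch k p) h true h' & agree k h h' /\ h' k = first_pos P.
Proof.
move=> pP.
suff loop m h1 : agree k h h1 -> m = N.+1 - h1 k ->
    (forall v : pos, v < h1 k -> ~~ P v) ->
    exists2 h', exec (PWhile (PIf p (PRet H false)
        (PIf (PSym k rend) (PRet H false) (PMove k true)))) h1 true h' &
      agree k h h' /\ h' k = first_pos P.
  have [||h' e' a'] := loop _ (set_head h k ord0) _ erefl.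
  - exact: agree_set.
  - by rewrite set_head_same.
  by exists h' => //; apply: exec_seq (exec_reset _ _) e'.
elim: m h1 => [|m IH] h1 a1 Em nP; have [h2 e2 a2] := pP _ a1.
  all: have hk : h2 k = h1 k by apply: a2.
  all: have a02 : agree k h h2 by apply: agree_trans a1 (agree_leq _ a2).
  all: have kN := ltn_ord (h1 k).
  all: have nP' : ~~ has (fun y : nat => P (inord y)) (iota 0 (h1 k))
    by apply/hasPn => j; rewrite mem_iota => /andP[_ jk]; apply: nP; rewrite inordK; lia.
  all: have szk : iota 0 N.+1 = iota 0 (h1 k) ++ iota (h1 k) (N.+1 - h1 k)
    by rewrite -iotaD subnKC //; lia.
  have hN : h1 k = N.+1 :> nat by lia.
  exists h2; last split=> //.
    apply: exec_stop; apply: exec_if e2 _.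
    case: (P _) => /=; first exact: exec_ret.
    apply: exec_ifT (exec_ret _ _); apply: exec_sym_eq.
    by rewrite letter_rend hk hN ltnSn.
  apply: val_inj; rewrite /= /first_pos szk find_cat (negbTE nP') size_iota.
  by rewrite hk hN subnn /= addn0 inordK.
case PE: (P (h1 k)) e2 => e2.
  exists h2; last split=> //.
    by apply: exec_stop; apply: exec_if e2 _; apply: exec_ret.
  apply: val_inj; rewrite /= /first_pos szk find_cat (negbTE nP') size_iota -Em /=.
  by rewrite inord_val PE addn0 hk inord_val.
set h3 := set_head h2 k (shift MoveR (h2 k)).
have E3 : h3 k = (h1 k).+1 :> nat by rewrite set_head_same hk /= inordK; lia.
have [||v|h' e' a'] := IH h3 _ _ _.
- exact: agree_trans a02 (agree_set _ _ _).
- by rewrite E3; lia.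
- rewrite E3 ltnS leq_eqVlt => /predU1P[/val_inj ->|/nP //].
  by rewrite PE.
exists h' => //; apply: exec_loop e'; apply: exec_if e2 _ => /=.
apply: exec_ifF (exec_move _ _ _); apply: exec_sym_eq.
by rewrite letter_rend hk; lia.
Qed.

(** A failed search ends at the last position, where [P] fails too. This is why [compile] runs the
    body of a quantifier once more after the search: the answer there decides the quantifier. *)
Lemma first_posP (P : pred pos) : P (first_pos P) = [exists v, P v].
Proof.
rewrite /first_pos; set Q := fun z : nat => P _.
have sN : find Q (iota 0 N.+1) <= N.+1 by rewrite -[X in _ <= X](size_iota 0) find_size.
apply/idP/existsP => [Pv|[v Pv]]; first by exists (inord (find Q (iota 0 N.+1))).
case: (boolP (has Q (iota 0 N.+1))) => hQ.
  have := nth_find 0 hQ; rewrite nth_iota //.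
  by move: hQ; rewrite has_find size_iota.
have -> : inord (find Q (iota 0 N.+1)) = v => //.
rewrite hasNfind // size_iota; apply: val_inj; rewrite /= inordK //.
have := ltn_ord v; rewrite ltnS leq_eqVlt => /predU1P[-> //|vN].
case/hasP: hQ; exists (v : nat); first by rewrite mem_iota.
by rewrite /Q inord_val.
Qed.

(** The clause [agree d h h'] carries the induction: a subprogram may displace scratch heads but
    restores or spares those holding variables, so the environment can be read again after it. *)
Lemma compile_correct f (rho : nat -> head) d h : (forall x, rho x < d) -> d + width f <= H.+1 ->
  exists2 h', exec (compile f rho d) h (eval f (fun x => h (rho x))) h' & agree d h h'.
Proof.
elim: f rho d h => /=.
- by move=> a x rho d h _ _; exists h => //; apply: exec_sym.
- by move=> x y rho d h _ _; exists h => //; apply: exec_eq.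
- move=> x y rho d h rd; rewrite addn1 => dH.
  set k : head := inord d; have kd : k = d :> nat by rewrite inordK.
  have kne z : k != rho z by rewrite -val_eqE /= kd gtn_eqF.
  (* The successor is tested by moving a copy of [y] to the left. At position 0 this copy would not
     move and could equal [x], so that case is rejected first. *)
  case: (posnP (h (rho y))) => [y0|y0].
    exists h => //; rewrite y0 /=; apply: exec_ifT (exec_ret _ _).
    by apply: exec_sym_eq; rewrite letter_lend y0.
  set h1 := set_head h k (h (rho y)).
  set h2 := set_head h1 k (shift MoveL (h1 k)).
  exists h2; last by apply: agree_trans (agree_set _ _ _) (agree_set _ _ _); rewrite kd.
  apply: exec_ifF; first by apply: exec_sym_eq; rewrite letter_lend gtn_eqF.
  apply: exec_seq (exec_copy _ (kne _)) _; apply: exec_seq (exec_move _ _ _) _.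
  apply: exec_eq_eq; rewrite /= -/h1 -/h2 /h2 set_head_same /h1 set_head_same.
  rewrite !ffunE ![rho x == k]eq_sym (negbTE (kne x)) -val_eqE /= inordK;
    last by have := ltn_ord (h (rho y)); lia.
  by lia.
- move=> f IH rho d h rd dH; have [h' e' a'] := IH _ _ h rd dH.
  by exists h' => //; apply: exec_if e' _; case: (eval _ _); apply: exec_ret.
- move=> f IHf g IHg rho d h rd; rewrite addn_maxr geq_max => /andP[dHf dHg].
  have [h' e' a'] := IHf _ _ h rd dHf; case E: (eval _ _) e' => e'; last first.
    by exists h' => //; apply: exec_if e' _; apply: exec_ret.
  have [h2 e2 a2] := IHg _ _ h' rd dHg; exists h2; last exact: agree_trans a' a2.
  apply: exec_if e' _; rewrite (@eval_ext w g _ (fun x => h' (rho x))) // => x.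
  by rewrite a'.
- move=> x f IH rho d h rd; rewrite addnS -addSn => dH.
  set k : head := inord d; have kd : k = d :> nat by rewrite inordK //; lia.
  set P := fun v => eval f (upd (fun x => h (rho x)) x v).
  have pP h1 : agree k h h1 ->
      exists2 h2, exec (compile f (upd rho x k) d.+1) h1 (P (h1 k)) h2 & agree k.+1 h1 h2.
    move=> a1; have [|h2 e2 a2] := IH (upd rho x k) _ h1 _ dH.
      by move=> y; rewrite /upd; case: eqP; rewrite ?kd // => _; apply: leqW.
    exists h2; last by rewrite kd.
    rewrite /P (@eval_ext w f _ (fun y => h1 (upd rho x k y))) // => y.
    by rewrite /upd; case: eqP => // _; rewrite a1 // kd.
  have [h1 e1 [a1 E1]] := exec_search pP; have [h2 e2 a2] := pP _ a1.
  exists h2; last by rewrite -kd; apply: agree_trans a1 (agree_leq _ a2).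
  by apply: exec_seq e1 _; rewrite (_ : [exists v, _] = P (h1 k)) // E1 first_posP.
- move=> x y f IH a m b rho d h rd; rewrite !addnS => dH.
  set c : head := inord d; set n : head := inord d.+1; set t : head := inord d.+2.
  have cd : c = d :> nat by rewrite inordK //; lia.
  have nd : n = d.+1 :> nat by rewrite inordK //; lia.
  have td : t = d.+2 :> nat by rewrite inordK //; lia.
  have cne z : c != rho z by rewrite -val_eqE /= cd gtn_eqF.
  have nne z : n != rho z by rewrite -val_eqE /= nd; have := rd z; lia.
  have ct : c != t by rewrite -val_eqE /= cd td; lia.
  have nt : n != t by rewrite -val_eqE /= nd td; lia.
  have cn : c != n by rewrite -val_eqE /= cd nd; lia.
  set p := compile f _ _.
  set g := fun v => first_pos _.
  set body := PIf (PEq n (rho m)) _ _.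
  (* [n] counts the rounds done, [c] holds the value reached, and [s] is the number of rounds
     left. *)
  have loop (s : nat) h1 : agree d h h1 -> s = h (rho m) - h1 n -> h1 n <= h (rho m) ->
      h1 c = iter (h1 n) g (h (rho a)) ->
      exists2 h2, exec (PWhile body) h1 true h2 &
        agree d h h2 /\ h2 c = iter (h (rho m)) g (h (rho a)).
    elim: s h1 => [|s IHq] h1 a1 Eq le E1.
      have En : h1 n = h (rho m) by apply: val_inj => /=; lia.
      exists h1; last by rewrite E1 En.
      apply: exec_stop; apply: exec_ifT (exec_ret _ _); apply: exec_eq_eq.
      by rewrite En a1 ?eqxx.
    pose P v := eval f (upd (upd (fun x => h (rho x)) x (h1 c)) y v).
    have pP h2 : agree t h1 h2 -> exists2 h3, exec p h2 (P (h2 t)) h3 & agree t.+1 h2 h3.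
      move=> a2; have [||h3 e3 a3] := IH (upd (upd rho x c) y t) d.+3 h2 _ _.
      - by move=> z; rewrite /upd; case: eqP => [_|_]; [|case: eqP => _]; rewrite ?td ?cd; have := rd z; lia.
      - by rewrite !addSn.
      exists h3; last by apply: agree_leq a3; rewrite td.
      rewrite /P (@eval_ext w f _ (fun z => h2 (upd (upd rho x c) y t z))) // => z.
      rewrite /upd; case: eqP => // _; case: eqP => _; first by rewrite a2 // cd td.
      by rewrite a2 ?a1 // td; have := rd z; lia.
    have [h2 e2 [a2 E2]] := exec_search (k := t) (h := h1) pP.
    have lt_ct : c < t by rewrite cd td.
    have lt_nt : n < t by rewrite nd td.
    set h3 := set_head h2 c (h2 t).
    have h3n : h3 n = h1 n by rewrite ffunE eq_sym (negbTE cn) a2.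
    set h4 := set_head h3 n (shift MoveR (h3 n)).
    have a4 : agree d h h4.
      apply: agree_trans a1 _; apply: agree_trans (agree_leq _ a2) _; first by rewrite td; lia.
      by apply: agree_trans (agree_set _ _ _) (agree_set _ _ _); rewrite ?cd ?nd.
    have h4n : h4 n = (h1 n).+1 :> nat.
      by rewrite set_head_same h3n /= inordK; have := ltn_ord (h (rho m)); lia.
    have [|||h5 e5 [a5 E5]] := IHq h4 a4; rewrite ?h4n; try lia.
      by rewrite iterS -E1 ffunE (negbTE cn) /h3 set_head_same E2.
    exists h5 => //; apply: exec_loop e5; apply: exec_ifF.
      apply: exec_eq_eq; rewrite (a1 (rho m)) //; apply/eqP => En.
      by rewrite En in Eq; lia.
    apply: exec_seq e2 _; apply: exec_seq (exec_copy _ ct) _.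
    exact: exec_move.
  set h1 := set_head h c (h (rho a)).
  set h2 := set_head h1 n ord0.
  have a2 : agree d h h2.
    by apply: agree_trans (agree_set _ _ _) (agree_set _ _ _); rewrite ?cd ?nd.
  have [||h3 e3 [a3 E3]] := loop _ h2 a2 erefl; rewrite ?set_head_same //.
    by rewrite ffunE (negbTE cn) /h1 set_head_same.
  exists h3 => //; apply: exec_seq (exec_copy _ (cne _)) _.
  apply: exec_seq (exec_reset _ _) _; apply: exec_seq e3 _.
  by apply: exec_eq_eq; rewrite E3 a3.
- by move=> f IH g rho d h rd dH; apply: IH.
Qed.

End Compile.

Arguments eval : simpl never.

Definition holds (w : seq (option bool)) (f : form) : bool := eval f (fun=> @ord0 (size w).+1).

(** All variables start on head 0, which ends every subprogram at position 0 as it began; scratch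
    begins at head 1. *)
Lemma form_machine f : exists (M : TM) (a b : nat), forall w, 0 < size w -> forall t,
  (accepts_within M w t -> holds w f) /\
  (holds w f -> a * (size w).+1 ^ b <= t -> accepts_within M w t).
Proof.
set p := compile f (fun=> @ord0 (width f).+1) 1.
set C := #|{: pstate p + bool}|.
exists (simulator p), ((C * 2 ^ (width f).+2 + 1) * 6), (width f).+3 => w w0 t.
have dH : 1 + width f <= (width f).+2 by rewrite add1n.
have [h e _] := @compile_correct _ w f (fun=> ord0) 1 (heads0 _ w) (fun=> isT) dH.
have -> : holds w f = eval f (fun=> heads0 (width f).+1 w ord0).
  by apply: eval_ext => x; rewrite ffunE.
have [Hs Hc] := simulator_decides w0 e t; split=> // ev tB; apply: Hc => //.
apply: leq_trans tB; rewrite -/C; set N := size w.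
(* The constants come from [N.+2 <= 2 * N.+1] for the number of head placements and
   [2 * N + 6 <= 6 * N.+1] for the cost of a sweep. *)
have N2 : N.+2 ^ (width f).+2 <= 2 ^ (width f).+2 * N.+1 ^ (width f).+2.
  by rewrite -expnMn leq_exp2r //; lia.
rewrite [_.+1 ^ _.+3]expnS; move: N2; set X := _ ^ _; set Y := 2 ^ _; set Z := N.+1 ^ _ => N2.
have Z0 : 0 < Z by rewrite expn_gt0.
apply: (@leq_trans ((C * Y + 1) * Z * (6 * N.+1))); last by lia.
rewrite leq_mul //; last lia.
rewrite mulnDl mul1n -addn1 leq_add // -mulnA leq_mul2l N2 orbT //.
Qed.

(* Locked, lest the evaluation rules of the primitive connectives fire on
   derived ones, to which they are convertible. *)
Definition FOr f g := locked (FNot (FAnd (FNot f) (FNot g))).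
Definition FImp f g := locked (FNot (FAnd f (FNot g))).
Definition FIff f g := locked (FAnd (FImp f g) (FImp g f)).
Definition FAll x f := locked (FNot (FEx x (FNot f))).
(** Parameter [i] of [f] is the variable [nth 0 args i] of the caller. Variables bound inside [f]
    live in its own numbering, so nothing is captured. *)
Definition FCall f (args : seq nat) := FSub f (nth 0 args).

(** * Saturating arithmetic in the formula language *)

Section Arithmetic.
Variable w : seq (option bool).
Notation N := (size w).
Notation B := N.+1.
Notation pos := 'I_B.+1.
Implicit Types (f g : form) (e : nat -> pos).

Lemma eval_sym a x e : eval (FSym a x) e = (letter w (e x) == a).
Proof. by []. Qed.

Lemma eval_eq x y e : eval (FEq x y) e = (e x == e y :> nat).
Proof. by []. Qed.

Lemma eval_succ x y e : eval (FSucc x y) e = ((e x).+1 == e y :> nat).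
Proof. by []. Qed.

Lemma eval_not f e : eval (FNot f) e = ~~ eval f e.
Proof. by []. Qed.

Lemma eval_and f g e : eval (FAnd f g) e = eval f e && eval g e.
Proof. by []. Qed.

Lemma eval_ex x f e : eval (FEx x f) e = [exists v, eval f (upd e x v)].
Proof. by []. Qed.

Lemma eval_call f s e : eval (FCall f s) e = eval f (fun x => e (nth 0 s x)).
Proof. by []. Qed.

Lemma eval_iter x y f a m b e : eval (FIter x y f a m b) e =
  (iter (e m) (fun v => first_pos (fun u => eval f (upd (upd e x v) y u))) (e a) == e b :> nat).
Proof. by []. Qed.

Lemma eval_or f g e : eval (FOr f g) e = eval f e || eval g e.
Proof. by rewrite /FOr -lock !eval_not eval_and !eval_not negb_and !negbK. Qed.

Lemma eval_imp f g e : eval (FImp f g) e = (eval f e ==> eval g e).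
Proof. by rewrite /FImp -lock eval_not eval_and eval_not negb_and negbK implybE. Qed.

Lemma eval_iff f g e : eval (FIff f g) e = (eval f e == eval g e).
Proof. by rewrite /FIff -lock eval_and !eval_imp; case: (eval f e); case: (eval g e). Qed.

Lemma eval_all x f e : eval (FAll x f) e = [forall v, eval f (upd e x v)].
Proof.
by rewrite /FAll -lock eval_not eval_ex negb_exists; apply: eq_forallb => v; rewrite eval_not negbK.
Qed.

Definition evalE := (eval_sym, eval_eq, eval_succ, eval_not, eval_and, eval_ex, eval_call,
  eval_or, eval_imp, eval_iff, eval_all).

(** Beyond [B] every letter reads as [rend]. So a saturated address reads the same letter as the
    true one, and addresses need no overflow check. *)
Lemma letter_min i : letter w (minn i B) = letter w i.
Proof.
case: (leqP i B) => // iB.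
rewrite [RHS](eqP (_ : letter w i == rend)); last by rewrite letter_rend; lia.
by apply/eqP; rewrite letter_rend.
Qed.

Lemma first_pos_least (P : pred pos) (v : pos) :
  (forall u : pos, u < v -> ~~ P u) -> P v \/ v = B :> nat -> first_pos P = v.
Proof.
move=> nP Pv; rewrite /first_pos.
have vB : v <= B by rewrite -ltnS.
rewrite -[in iota _ _](subnKC vB) iotaD find_cat.
case: ifP => [/hasP[k]|_].
  rewrite mem_iota => /andP[_ kv]; have kB : k < B.+1 by lia.
  by apply: contraTeq => _; apply: nP; rewrite inordK.
rewrite size_iota; case: Pv => [Pv|vE]; last first.
  by rewrite [X in iota _ (_ - X)]vE subnn addn0 inord_val.
case E: (B - v) => [|m] /=; first by rewrite addn0 inord_val.
by rewrite inord_val Pv addn0 inord_val.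
Qed.

Lemma first_pos_eq (P : pred pos) k : (forall u : pos, P u = (k == u :> nat)) ->
  first_pos P = minn k B :> nat.
Proof.
move=> Pk; have kB : minn k B < B.+1 by lia.
rewrite (@first_pos_least P (inord (minn k B))) ?inordK // => [u|]; rewrite ?Pk ?inordK //; lia.
Qed.

(* Arithmetic saturates at the last position [B], because [first_pos] does. *)
Definition FPlus := FIter 3 4 (FSucc 3 4) 0 1 2.

Lemma eval_plus e : eval FPlus e = (minn (e 0 + e 1) B == e 2).
Proof.
rewrite eval_iter; congr (_ == _).
elim: (e 1 : nat) => [|m IH]; first by rewrite addn0 /=; have := ltn_ord (e 0); lia.
rewrite iterS (@first_pos_eq _ (minn (e 0 + m) B).+1) => [|u]; first lia.
by rewrite eval_succ /upd /= IH.
Qed.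

Definition FTimes := FEx 5 (FAnd (FSym lend 5) (FIter 3 4 (FCall FPlus [:: 3; 1; 4]) 5 0 2)).

Lemma eval_times e : eval FTimes e = (minn (e 0 * e 1) B == e 2).
Proof.
have it e' : e' 5 = ord0 ->
   eval (FIter 3 4 (FCall FPlus [:: 3; 1; 4]) 5 0 2) e' = (minn (e' 0 * e' 1) B == e' 2).
  move=> e5; rewrite eval_iter; congr (_ == _).
  elim: (e' 0 : nat) => [|m IH]; first by rewrite /= e5 mul0n min0n.
  rewrite iterS (@first_pos_eq _ (minn (minn (m * e' 1) B + e' 1) B)) => [|u].
    by rewrite mulSn; lia.
  by rewrite eval_call eval_plus /upd /= IH.
rewrite /FTimes eval_ex; apply/existsP/idP => [[v]|E].
  rewrite eval_and eval_sym => /andP[v0]; rewrite it //.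
  by apply/val_inj/eqP; rewrite -(letter_lend w).
by exists ord0; rewrite eval_and eval_sym letter_lend it.
Qed.

Inductive term := TVar of nat | TOne | TAdd of term & term | TMul of term & term.

Fixpoint tval (e : nat -> nat) (t : term) : nat :=
  match t with
  | TVar x => e x
  | TOne => 1
  | TAdd t u => tval e t + tval e u
  | TMul t u => tval e t * tval e u
  end.

Fixpoint tbound (k : nat) (t : term) : bool :=
  match t with
  | TVar x => x < k
  | TOne => true
  | TAdd t u | TMul t u => tbound k t && tbound k u
  end.

Fixpoint FTerm (k : nat) (t : term) (x : nat) : form :=
  match t with
  | TVar y => FEq y x
  | TOne => FEx k (FAnd (FSym lend k) (FSucc k x))
  | TAdd t u => FEx k (FEx k.+1 (FAnd (FTerm k.+2 t k)
      (FAnd (FTerm k.+2 u k.+1) (FCall FPlus [:: k; k.+1; x]))))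
  | TMul t u => FEx k (FEx k.+1 (FAnd (FTerm k.+2 t k)
      (FAnd (FTerm k.+2 u k.+1) (FCall FTimes [:: k; k.+1; x]))))
  end.

Lemma tval_upd (e : nat -> pos) k k' v t : tbound k t -> k <= k' ->
  tval (upd e k' v) t = tval e t.
Proof.
move=> tk kk'; elim: t tk => //= [x xk|t IHt u IHu|t IHt u IHu].
- by rewrite /upd; case: eqP => // ?; lia.
- by case/andP=> /IHt -> /IHu ->.
- by case/andP=> /IHt -> /IHu ->.
Qed.

Lemma tboundW k k' t : k <= k' -> tbound k t -> tbound k' t.
Proof.
by move=> kk'; elim: t => //= [x /leq_trans -> //|t IHt u IHu|t IHt u IHu]; case/andP=> /IHt-> /IHu->.
Qed.

Lemma eval_term k t x e : tbound k t -> x < k ->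
  eval (FTerm k t x) e = (minn (tval e t) B == e x).
Proof.
pose ev m := inord (minn m B) : pos.
have evK m : ev m = minn m B :> nat by rewrite inordK; lia.
have binop op g u u' k' x' e' : (forall e, eval g e = (minn (op (e 0 : nat) (e 1 : nat)) B == e 2)) ->
    (forall i j, minn (op (minn i B) (minn j B)) B = minn (op i j) B) -> x' < k' ->
    tbound k' u -> tbound k' u' ->
    (forall y e, y < k'.+2 -> eval (FTerm k'.+2 u y) e = (minn (tval e u) B == e y)) ->
    (forall y e, y < k'.+2 -> eval (FTerm k'.+2 u' y) e = (minn (tval e u') B == e y)) ->
    eval (FEx k' (FEx k'.+1 (FAnd (FTerm k'.+2 u k')
      (FAnd (FTerm k'.+2 u' k'.+1) (FCall g [:: k'; k'.+1; x']))))) e' =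
    (minn (op (tval e' u) (tval e' u')) B == e' x').
  move=> gE opB xk uk uk' IH IH'.
  have E (v v' : pos) : eval (FAnd (FTerm k'.+2 u k')
      (FAnd (FTerm k'.+2 u' k'.+1) (FCall g [:: k'; k'.+1; x']))) (upd (upd e' k' v) k'.+1 v') =
    [&& minn (tval e' u) B == v, minn (tval e' u') B == v' & minn (op v v') B == e' x'].
    rewrite !eval_and eval_call gE IH // IH' //= !(tval_upd _ _ uk) // !(tval_upd _ _ uk') //.
    rewrite /upd !eqxx (ltn_eqF (ltnSn k')) (ltn_eqF xk) (ltn_eqF (ltnW _ : x' < k'.+1)) //.
  rewrite eval_ex; apply/existsP/idP => [[v]|F].
    rewrite eval_ex => /existsP[v']; rewrite E => /and3P[/eqP Ev /eqP Ev'].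
    by rewrite -Ev -Ev' opB.
  exists (ev (tval e' u)); rewrite eval_ex; apply/existsP; exists (ev (tval e' u')).
  by rewrite E !evK !eqxx opB.
elim: t k x e => [y|| t IHt u IHu | t IHt u IHu] k x e.
- by move=> yk xk; rewrite /= eval_eq (minn_idPl _) // -ltnS.
- move=> _ xk; rewrite /= eval_ex; apply/existsP/idP => [[v]|E].
    rewrite eval_and eval_sym eval_succ letter_lend /upd eqxx (ltn_eqF xk) => /andP[/eqP ->].
    by rewrite (minn_idPl _).
  exists ord0; rewrite eval_and eval_sym eval_succ letter_lend /upd eqxx (ltn_eqF xk) /=.
  by move: E; rewrite (minn_idPl _).
- case/andP=> tk uk xk; apply: (binop addn) => // [e'|i j|y e' yk|y e' yk].
  + exact: eval_plus.
  + lia.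
  + by apply: IHt => //; apply: tboundW tk; lia.
  + by apply: IHu => //; apply: tboundW uk; lia.
- case/andP=> tk uk xk; apply: (binop muln) => // [e'|i j|y e' yk|y e' yk].
  + exact: eval_times.
  (* Saturating the factors first is harmless: a factor of at least [B] times a nonzero one is still
     at least [B]. Zero factors are split off. *)
  + case: (posnP i) => [->|i0]; first by rewrite ?(min0n, mul0n).
    case: (posnP j) => [->|j0]; first by rewrite ?(min0n, muln0).
    case: (leqP i B) => iB; case: (leqP j B) => jB //; nia.
  + by apply: IHt => //; apply: tboundW tk; lia.
  + by apply: IHu => //; apply: tboundW uk; lia.
Qed.

Definition FTermSym k (a : sym) t := locked (FEx k (FAnd (FTerm k.+1 t k) (FSym a k))).

Lemma eval_term_sym k a t e : tbound k t ->
  eval (FTermSym k a t) e = (letter w (tval e t) == a).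
Proof.
move=> tk; have E v : eval (FAnd (FTerm k.+1 t k) (FSym a k)) (upd e k v) =
    (minn (tval e t) B == v) && (letter w v == a).
  rewrite eval_and eval_sym eval_term ?(tboundW _ tk) // (tval_upd _ _ tk) //.
  by rewrite /upd eqxx.
rewrite /FTermSym -lock eval_ex -[letter w (tval _ _)]letter_min /=.
apply/existsP/idP => [[v]|Ea]; first by rewrite E => /andP[/eqP ->].
by exists (inord (minn (tval e t) B)); rewrite E inordK ?eqxx //; lia.
Qed.

Definition FLe := locked (FEx 2 (FCall FPlus [:: 0; 2; 1])).

Lemma eval_le e : eval FLe e = (e 0 <= e 1).
Proof.
rewrite /FLe -lock eval_ex; apply/existsP/idP => [[v]|le].
  by rewrite eval_call eval_plus /upd /=; have := ltn_ord (e 0); lia.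
exists (inord (e 1 - e 0)); rewrite eval_call eval_plus /upd /= inordK.
  by have := ltn_ord (e 1); lia.
by have := ltn_ord (e 1); lia.
Qed.

Definition FLt x y := locked (FAnd (FCall FLe [:: x; y]) (FNot (FEq x y))).

Lemma eval_lt x y e : eval (FLt x y) e = (e x < e y).
Proof. by rewrite /FLt -lock eval_and eval_call eval_le /= eval_not eval_eq; lia. Qed.

Definition FHalf := FOr (FTerm 2 (TAdd (TVar 1) (TVar 1)) 0)
                        (FTerm 2 (TAdd (TAdd (TVar 1) (TVar 1)) TOne) 0).
Definition FOdd := FEx 1 (FTerm 2 (TAdd (TAdd (TVar 1) (TVar 1)) TOne) 0).
Definition FDivPow2 := FIter 3 4 (FCall FHalf [:: 3; 4]) 0 1 2.

(** Below [B] the value [2 v + 1] cannot have been cut off. At [B] itself every large [v] would pass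
    as a half, whatever the parity. *)
Lemma eval_odd e : e 0 < B -> eval FOdd e = odd (e 0).
Proof.
move=> e0; rewrite eval_ex; apply/existsP/idP => [[v]|od].
  by rewrite eval_term //= /upd /=; lia.
by exists (inord (e 0)./2); rewrite eval_term //= /upd /= inordK; lia.
Qed.

Lemma eval_divpow2 e : e 0 < B -> eval FDivPow2 e = (e 0 %/ 2 ^ e 1 == e 2).
Proof.
move=> e0; rewrite eval_iter; congr (_ == _).
elim: (e 1 : nat) => [|m IH]; first by rewrite divn1.
rewrite iterS; set v := iter m _ _ in IH *.
have -> : e 0 %/ 2 ^ m.+1 = v %/ 2 by rewrite expnSr divnMA -IH.
have vB : v < B by rewrite IH (leq_ltn_trans (leq_div _ _)).
rewrite (@first_pos_eq _ (v %/ 2)) => [|u]; first by lia.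
rewrite eval_call eval_or !eval_term //= /upd /=.
by apply/idP/idP; lia.
Qed.

End Arithmetic.

(** * Grid paths and their contraction *)

Section GridPaths.
Implicit Types (p q r : gpoint) (e f g : gedge) (s : seq gpoint) (E : seq gedge).

Definition touch e f : bool := has (mem (edge_ends f)) (edge_ends e).

Lemma common_points0 e f : (common_points e f == [::]) = ~~ touch e f.
Proof. by rewrite /touch has_filter negbK. Qed.

Lemma size_common_points e f : e != f -> (size (common_points e f) == 1) = touch e f.
Proof.
move=> ef; rewrite /touch has_count -size_filter -/(common_points e f).
suff : size (common_points e f) <= 1 by case: (size _) => [|[]].
rewrite size_filter; case: e f ef => [[x y] []] [[x' y'] []] /=;
  rewrite !inE !xpair_eqE ?andbT ?andbF /=; lia.
Qed.

Lemma touch_refl e : touch e e.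
Proof. by case: e => [[x y] []]; rewrite /touch /= !inE eqxx. Qed.

Notation e0 := ((0, 0, true)%R : gedge).

(** Distinctness matters only between consecutive edges: an edge touches itself, so a repetition
    further apart breaks the last clause. For distinct edges, touching means sharing exactly one
    point. *)
Lemma grid_pathP E : grid_path E <->
  [/\ 0 < size E,
   forall i, i.+1 < size E -> touch (nth e0 E i) (nth e0 E i.+1) &&
                              (nth e0 E i != nth e0 E i.+1) &
   forall i j, i.+1 < j -> j < size E -> ~~ touch (nth e0 E i) (nth e0 E j)].
Proof.
split=> [[E0 uE cE nE]|[E0 cE nE]].
  split=> // [i iE|i j ij jE]; last by rewrite -common_points0 nE.
  have ne : nth e0 E i != nth e0 E i.+1 by rewrite nth_uniq ?(ltnW iE) // ltn_eqF.
  by rewrite -size_common_points // cE // eqxx.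
split=> // [|i iE|i j ij jE]; last by apply/eqP; rewrite common_points0 nE.
  apply/(uniqPn e0)=> -[i [j [ij jE Eij]]].
  have [iE|] := ltnP i.+1 j; first by have := nE i j iE jE; rewrite Eij touch_refl.
  rewrite leq_eqVlt ltnNge ij orbF => /eqP ji; subst j.
  by have /andP[_] := cE i jE; rewrite Eij eqxx.
by have /andP[t ne] := cE i iE; apply/eqP; rewrite size_common_points.
Qed.

Definition gadj p q : bool :=
  ((p.1 == q.1) && ((q.2 == p.2 + 1)%R || (p.2 == q.2 + 1)%R)) ||
  ((p.2 == q.2) && ((q.1 == p.1 + 1)%R || (p.1 == q.1 + 1)%R)).

Definition gedge_of p q : gedge := ((Num.min p.1 q.1, Num.min p.2 q.2), p.2 == q.2).

Lemma gedge_ofC p q : gedge_of p q = gedge_of q p.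
Proof. by rewrite /gedge_of minC [Num.min p.2 _]minC eq_sym. Qed.

Lemma gadjC p q : gadj p q = gadj q p.
Proof. by rewrite /gadj; lia. Qed.

Lemma gadj_neq p q : gadj p q -> p != q.
Proof. by case: p q => [x y] [x' y']; rewrite /gadj xpair_eqE /=; lia. Qed.

Lemma mem_ends p q r : gadj p q -> (r \in edge_ends (gedge_of p q)) = (r == p) || (r == q).
Proof.
case: p q r => [x y] [x' y'] [x'' y'']; rewrite /gadj /gedge_of /=.
by case: ifP; rewrite !inE !xpair_eqE /=; lia.
Qed.

Lemma edge_ends_gedge_of e p : p \in edge_ends e ->
  exists2 q, gadj q p & gedge_of q p = e.
Proof.
case: e p => [[x y] []] [x' y'] /=; rewrite !inE !xpair_eqE => /orP[] /andP[/eqP -> /eqP ->].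
- by exists (x + 1, y)%R; rewrite /gadj /gedge_of /=; [lia | congr (_, _, _); lia].
- by exists (x, y)%R; rewrite /gadj /gedge_of /=; [lia | congr (_, _, _); lia].
- by exists (x, y + 1)%R; rewrite /gadj /gedge_of /=; [lia | congr (_, _, _); lia].
- by exists (x, y)%R; rewrite /gadj /gedge_of /=; [lia | congr (_, _, _); lia].
Qed.

Lemma gedge_of_inj p q p' q' : gadj p q -> gadj p' q' -> gedge_of p q = gedge_of p' q' ->
  (p == p') && (q == q') || (p == q') && (q == p').
Proof.
move=> pq pq' E.
have Ep r : (r == p) || (r == q) = ((r == p') || (r == q')) by rewrite -!mem_ends // E.
have := gadj_neq pq; have := Ep p; have := Ep q; rewrite !eqxx orbT /=.
by do 2 case/esym/orP => /eqP ->; rewrite !eqxx ?orbT.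
Qed.

(** Grid paths are handled as self-avoiding walks on points, because contracting a column then
    amounts to deleting points. *)
Definition walk := (gpoint * seq gpoint)%type.
Implicit Type W : walk.

Definition walk_edges W : seq gedge := pairmap gedge_of W.1 W.2.

Definition is_walk W : bool := [&& W.2 != [::], uniq (W.1 :: W.2) & path gadj W.1 W.2].

Lemma grid_path_walk W : is_walk W -> grid_path (walk_edges W).
Proof.
case: W => p s /and3P[/= s0 us ps]; apply/grid_pathP; rewrite size_pairmap.
have adj i : i < size s -> gadj (nth p (p :: s) i) (nth p (p :: s) i.+1).
  by move=> iE; apply: (pathP p ps).
have nthE i : i < size s ->
    nth e0 (walk_edges (p, s)) i = gedge_of (nth p (p :: s) i) (nth p (p :: s) i.+1).
  by move=> iE; rewrite (nth_pairmap p).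
have nth_eq i j : i <= size s -> j <= size s ->
   (nth p (p :: s) i == nth p (p :: s) j) = (i == j) by move=> iE jE; rewrite nth_uniq.
split=> [|i iE|i j ij jE]; first by case: (s) s0.
  have iE' := ltnW iE; rewrite !nthE //; apply/andP; split.
    apply/hasP; exists (nth p (p :: s) i.+1); rewrite ?inE mem_ends ?eqxx ?orbT //; exact: adj.
  apply/eqP => E; have := gedge_of_inj (adj _ iE') (adj _ iE) E.
  by rewrite !nth_eq ?(ltnW iE') //; lia.
have iE : i < size s by apply: ltn_trans (ltnW ij) jE.
rewrite !nthE //; apply/hasP => -[q qj qi].
move: qj (qi : q \in edge_ends _); rewrite !mem_ends ?adj //.
by case/orP=> /eqP ->; rewrite !nth_eq ?(ltnW iE) ?(ltnW jE) //; lia.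
Qed.

Lemma mem_walk_edge p s q : path gadj p s -> q \in s ->
  exists2 e, e \in walk_edges (p, s) & q \in edge_ends e.
Proof.
elim: s p => //= r s IH p /andP[pr rs]; rewrite inE => /predU1P[->|qs].
  by exists (gedge_of p r); rewrite ?inE ?eqxx // mem_ends // eqxx orbT.
by have [e es qe] := IH _ rs qs; exists e => //; rewrite inE es orbT.
Qed.

(** Edges carry no orientation, so the walk is built from its last edge backwards. The new edge
    meets the first edge of the walk at its starting point, except that a walk of a single edge may
    have to be reversed. *)
Lemma walk_of_grid_path E : grid_path E -> exists2 W, is_walk W & walk_edges W = E.
Proof.
move=> /grid_pathP; elim: E => [[]//|e [_ _|f E IH [_ cE nE]]].
  have [|q qp eE] := @edge_ends_gedge_of e e.1; first by case: (e) => -[? ?] []; rewrite inE eqxx.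
  exists (q, [:: e.1]); last by rewrite /walk_edges /= eE.
  by rewrite /is_walk /= inE gadj_neq // qp.
have [|[p [|q s]]] := IH.
- split=> // i; first exact: (cE i.+1).
  by move=> j ij jE; apply: (nE i.+1 j.+1).
- by [].
rewrite /is_walk /= => /andP[/andP[pq /andP[qs us]] /andP[pqa ps]] [Ef EE].
have := cE 0 isT; rewrite /= => /andP[tef nef].
have nte g : g \in E -> ~~ touch e g.
  by move=> /(nthP e0)[i iE <-]; apply: (nE 0 i.+2).
have nts r : r \in s -> r \notin edge_ends e.
  move=> /(mem_walk_edge ps)[g gE rg]; apply: contraNN (nte g _) => [re|]; last by rewrite -EE.
  by apply/hasP; exists r.
have [r re] := hasP tef; rewrite -[f in edge_ends f]Ef /= mem_ends // => rpq.
have [u ur ue] := edge_ends_gedge_of re.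
have uE : u \in edge_ends e by rewrite -ue mem_ends // eqxx.
have us' : u \notin s by apply: contraTN uE => /nts.
move: pq; rewrite inE negb_or => /andP[pq pns].
case/orP: rpq => /eqP rE; subst r.
  exists (u, [:: p, q & s]); last by rewrite /walk_edges /= ue Ef -EE.
  rewrite /is_walk /= !inE !negb_or gadj_neq // ur pq pns qs us pqa ps us' !andbT /=.
  by apply: contraNneq nef => uq; rewrite -ue uq gedge_ofC Ef.
(* Here [e] meets [f] at its far end [q]. A further edge at [q] would touch [e] without being
   consecutive to it, so [f] is the last edge and is traversed backwards. *)
case: s EE qs us us' nts ps pns => [|r s] EE qs us us' nts ps pns.
  exists (u, [:: q; p]); last by rewrite /walk_edges /= ue gedge_ofC Ef -EE.
  rewrite /is_walk /= !inE !negb_or gadj_neq // ur gadjC pqa andbT /=.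
  rewrite (contraNneq _ nef) => [|up]; first by rewrite [q == p]eq_sym pq.
  by rewrite -ue up Ef.
have := nte (gedge_of q r); rewrite -EE inE eqxx => /(_ isT)/hasP[].
exists q => //; have /andP[qr _] := ps.
by have := mem_ends q qr; rewrite eqxx.
Qed.

Fixpoint changes (l : seq bool) : nat :=
  if l is a :: l' then (if l' is b :: _ then (a != b) + changes l' else 0) else 0.

Lemma bends_changes E : bends E = changes (map edge_dir E).
Proof.
elim: E => [|e [|f E] IH]; rewrite /bends ?big_ord0 //=.
by rewrite big_ord_recl /= -/(bends (f :: E)) IH.
Qed.

End GridPaths.

Arguments changes : simpl never.

(** The paths through [e] all pass through one edge [e'] of the other family. Adjacency and the
    Helly property only ask which sets of paths have a common edge, so embeddings both ways preserve
    them, even when edges are merged. *)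
Definition embeds (V : Type) (A B : V -> seq gedge) : Prop :=
  forall e, exists e', forall v, e \in A v -> e' \in B v.

Section Transfer.
Variables (n : nat) (A B : 'I_n -> seq gedge).
Hypotheses (AB : embeds A B) (BA : embeds B A).

Lemma share_transfer u v : (exists e, (e \in A u) && (e \in A v)) <->
  (exists e, (e \in B u) && (e \in B v)).
Proof.
split=> -[e /andP[eu ev]].
  by have [e' H] := AB e; exists e'; rewrite !H.
by have [e' H] := BA e; exists e'; rewrite !H.
Qed.

Lemma Helly_transfer : Helly_family A -> Helly_family B.
Proof.
move=> HA S SB; have [u v uS vS|e eS] := HA S; first by apply/share_transfer/SB.
by have [e' H] := AB e; exists e' => v vS; apply/H/eS.
Qed.

End Transfer.

Definition walk_rep (k n : nat) (adj : 'I_n -> 'I_n -> bool) (W : 'I_n -> walk) : Prop :=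
  [/\ forall v, is_walk (W v),
      forall v, changes (map edge_dir (walk_edges (W v))) <= k,
      forall u v, u != v -> (adj u v <->
        exists e, (e \in walk_edges (W u)) && (e \in walk_edges (W v))) &
      Helly_family (fun v => walk_edges (W v))].

Lemma walk_rep_Helly k n adj (W : 'I_n -> walk) : walk_rep k adj W ->
  Bk_EPG_rep k adj (fun v => walk_edges (W v)) /\ Helly_family (fun v => walk_edges (W v)).
Proof.
case=> Ww Wk Wa WH; split=> //; split; last by move=> v; rewrite bends_changes.
by split=> // v; apply: grid_path_walk.
Qed.

Lemma Helly_walk_rep k n (adj : 'I_n -> 'I_n -> bool) :
  has_Helly_Bk_EPG k adj -> exists W : 'I_n -> walk, walk_rep k adj W.
Proof.
case=> P [[[Pp Pa] Pk] PH].
have ex v : exists W, is_walk W && (walk_edges W == P v).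
  by have [W Ww WE] := walk_of_grid_path (Pp v); exists W; rewrite Ww WE eqxx.
pose W v := xchoose (ex v).
have WE v : walk_edges (W v) = P v by have /andP[_ /eqP] := xchooseP (ex v).
exists W; split=> [v|v|u v uv|S HS].
- by have /andP[] := xchooseP (ex v).
- by rewrite WE -bends_changes.
- by rewrite !WE; apply: Pa.
have [u v uS vS|e eS] := PH S; last by exists e => v /eS; rewrite WE.
by have [e] := HS u v uS vS; rewrite !WE => He; exists e.
Qed.

Lemma walk_rep_transfer k n (adj : 'I_n -> 'I_n -> bool) (W W' : 'I_n -> walk) :
  walk_rep k adj W -> (forall v, is_walk (W' v)) ->
  (forall v, changes (map edge_dir (walk_edges (W' v))) <=
             changes (map edge_dir (walk_edges (W v)))) ->
  embeds (fun v => walk_edges (W v)) (fun v => walk_edges (W' v)) ->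
  embeds (fun v => walk_edges (W' v)) (fun v => walk_edges (W v)) ->
  walk_rep k adj W'.
Proof.
case=> Ww Wk Wa WH Ww' le E1 E2; split=> // [v|u v uv|].
- exact: leq_trans (le v) (Wk v).
- by rewrite -(share_transfer E1 E2); apply: Wa.
exact: Helly_transfer E1 E2 WH.
Qed.

(** * Transposition of the grid *)

Section Swap.

Definition swap_pt (p : gpoint) : gpoint := (p.2, p.1).
Definition swap_edge (e : gedge) : gedge := (swap_pt e.1, ~~ e.2).
Definition swap_walk (W : walk) : walk := (swap_pt W.1, map swap_pt W.2).

Lemma swap_ptK : involutive swap_pt. Proof. by case. Qed.

Lemma gadj_swap p q : gadj (swap_pt p) (swap_pt q) = gadj p q.
Proof. by rewrite /gadj /= orbC. Qed.

Lemma gedge_of_swap p q : gadj p q ->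
  gedge_of (swap_pt p) (swap_pt q) = swap_edge (gedge_of p q).
Proof.
by rewrite /gadj /gedge_of /swap_edge /swap_pt /= => pq; congr (_, _); lia.
Qed.

Lemma walk_edges_swap W : is_walk W ->
  walk_edges (swap_walk W) = map swap_edge (walk_edges W).
Proof.
case: W => p s /and3P[_ _]; rewrite /walk_edges /=.
by elim: s p => //= q s IH p /andP[pq qs]; rewrite IH // gedge_of_swap.
Qed.

Lemma is_walk_swap W : is_walk W -> is_walk (swap_walk W).
Proof.
case: W => p s /and3P[/= s0 us ps]; apply/and3P; split=> /=; first by case: (s) s0.
  by rewrite -[_ && _]/(uniq (map swap_pt (p :: s))) map_inj_uniq //; apply: inv_inj swap_ptK.
by rewrite path_map; apply: sub_path ps => x y; rewrite /= gadj_swap.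
Qed.

Lemma changes_cons a b l : changes [:: a, b & l] = (a != b) + changes (b :: l).
Proof. by []. Qed.

Lemma changes_swap (E : seq gedge) :
  changes (map edge_dir (map swap_edge E)) = changes (map edge_dir E).
Proof.
elim: E => [|e [|f E] IH] //; rewrite !map_cons !changes_cons -!map_cons IH.
by rewrite /edge_dir /=; case: e.2; case: f.2.
Qed.

Lemma walk_rep_swap k n (adj : 'I_n -> 'I_n -> bool) (W : 'I_n -> walk) :
  walk_rep k adj W -> walk_rep k adj (fun v => swap_walk (W v)).
Proof.
move=> rW; have [Ww _ _ _] := rW; apply: (walk_rep_transfer rW).
- by move=> v; apply: is_walk_swap.
- by move=> v; rewrite walk_edges_swap // changes_swap.
- by move=> e; exists (swap_edge e) => v ev; rewrite walk_edges_swap // map_f.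
move=> e; exists (swap_edge e) => v; rewrite walk_edges_swap // => /mapP[f fv ->].
by rewrite /swap_edge negbK; case: f fv => -[].
Qed.

End Swap.

(** * Contraction of a column *)

Section Contract.
Variable a : int.
Local Open Scope ring_scope.

Definition contract_coord (x : int) : int := if a < x then x - 1 else x.
Definition contract_pt (p : gpoint) : gpoint := (contract_coord p.1, p.2).
Definition contract_edge (e : gedge) : gedge := (contract_pt e.1, e.2).
Definition contract_walk (W : walk) : walk :=
  (contract_pt W.1, map contract_pt [seq p <- W.2 | p.1 != a]).
(** The edge obtained by merging a crossing of column [a] is sent back to its left half, the one
    starting at [a - 1]. *)
Definition expand_edge (e : gedge) : gedge :=
  ((if a <= e.1.1 then e.1.1 + 1 else e.1.1, e.1.2), e.2).

Definition walk_cols (W : walk) : seq int :=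
  W.1.1 :: (last W.1 W.2).1 :: [seq e.1.1 | e <- walk_edges W & ~~ e.2].

Lemma contract_edgeK e : e.1.1 != a -> expand_edge (contract_edge e) = e.
Proof.
case: e => -[x y] d; rewrite /expand_edge /contract_edge /contract_pt /contract_coord /= => xa.
by congr (_, _, _); case: ifP; case: ifP; lia.
Qed.

Lemma contract_pt_inj : {in [pred p : gpoint | p.1 != a] &, injective contract_pt}.
Proof.
case=> x y [x' y']; rewrite !inE /contract_pt /contract_coord /= => xa xa' [Ex ->].
by congr (_, _); move: Ex; case: ifP; case: ifP; lia.
Qed.

Lemma contract_step p q : p.1 != a -> q.1 != a -> gadj p q ->
  gadj (contract_pt p) (contract_pt q) /\
  gedge_of (contract_pt p) (contract_pt q) = contract_edge (gedge_of p q).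
Proof.
case: p q => [x y] [x' y']; rewrite /gadj /gedge_of /contract_edge /contract_pt.
rewrite /contract_coord /= => xa xa' pq; split.
  by case: ifP; case: ifP; lia.
by congr (_, _, _); do 3 case: ifP; lia.
Qed.

(* The two edges through column [a] become one: the neighbours of a point of
   that column are the two horizontal ones. *)
Lemma contract_cross p q r : p.1 != a -> q.1 = a -> r.1 != a -> p != r ->
  gadj p q -> gadj q r ->
  gadj (contract_pt p) (contract_pt r) /\
  exists e f, [/\ (gedge_of p q, gedge_of q r) = (e, f) \/ (gedge_of p q, gedge_of q r) = (f, e),
    e = ((a - 1, q.2), true), f = ((a, q.2), true) &
    gedge_of (contract_pt p) (contract_pt r) = contract_edge e].
Proof.
case: p q r => [x y] [x' y'] [x'' y'']; rewrite /gadj /gedge_of /contract_edge /contract_pt.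
rewrite /contract_coord /= => xa -> {x'} ra; rewrite xpair_eqE => ne pq qr; split.
  by case: ifP; case: ifP; lia.
have [yy yy'] : y = y' /\ y'' = y' by lia.
subst y y''; rewrite minxx eqxx.
exists ((a - 1, y'), true), ((a, y'), true); split=> //.
  have [?|?] : (x = a - 1 /\ x'' = a + 1) \/ (x = a + 1 /\ x'' = a - 1) by lia.
    by left; congr (_, _, _, (_, _, _)); lia.
  by right; congr (_, _, _, (_, _, _)); lia.
by rewrite /=; congr (_, _, _); case: ifP; case: ifP; case: ifP; lia.
Qed.

Let pred_neq : a - 1 != a. Proof. by lia. Qed.

Let gedge_ofE p q : gedge_of p q = ((Num.min p.1 q.1, Num.min p.2 q.2), p.2 == q.2).
Proof. by []. Qed.

Local Opaque gedge_of.

(** The induction is on the size because a crossing of column [a] consumes two steps. The prepended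
    direction [d] stands for the preceding edge and lets the counts of changes chain. The last
    clause says that a crossing contains its left half along with its right one. *)
Lemma contract_walkP p s : p.1 != a -> (last p s).1 != a -> uniq (p :: s) ->
  path gadj p s -> a \notin [seq e.1.1 | e <- walk_edges (p, s) & ~~ e.2] ->
  let W := contract_walk (p, s) in
  [/\ path gadj W.1 W.2,
      walk_edges W = [seq contract_edge e | e <- walk_edges (p, s) & e.1.1 != a],
      forall d, changes (d :: map edge_dir (walk_edges W)) =
                changes (d :: map edge_dir (walk_edges (p, s))) &
      forall y, ((a, y), true) \in walk_edges (p, s) ->
                ((a - 1, y), true) \in walk_edges (p, s)].
Proof.
rewrite /walk_edges /contract_walk /=.
have [m] := ubnP (size s); elim: m s p => // m IH [|q s] p //= sm pa la.
case/andP=> pq us /andP[pqa qs] Ha.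
have [qa|qa] := eqVneq q.1 a; last first.
  have [cadj cedge] := contract_step pa qa pqa.
  have [|ps es cs hs] := IH s q sm qa la us qs.
    by apply: contraNN Ha; case: ifP => //= _; rewrite inE => ->; rewrite orbT.
  have ea : (gedge_of p q).1.1 != a.
    by rewrite gedge_ofE /=; move: pa qa; rewrite minEle; case: ifP.
  rewrite /= cadj ps ea /= cedge es; split=> // [d|y].
    by rewrite !changes_cons -(cs (gedge_of p q).2) es.
  by rewrite !inE => /predU1P[E|/hs ->]; [rewrite -E eqxx in ea | rewrite orbT].
case: s sm la us qs pq Ha => [|r s] /=; first by rewrite qa eqxx.
move=> sm la /andP[qns us] /andP[qra rs]; rewrite inE negb_or => /andP[_ ] pns Ha.
(* Two consecutive points of column [a] would span a vertical edge in it. *)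
have ra : r.1 != a.
  apply: contraNneq Ha => ra.
  have -> : ~~ (gedge_of q r).2.
    rewrite gedge_ofE /=; apply: contraNneq (gadj_neq qra) => q2.
    by rewrite -pair_eqE /pair_eq qa ra q2 !eqxx.
  by case: ifP => _ /=; rewrite !inE (gedge_ofE q r) /= qa ra minxx eqxx ?orbT.
have pr : p != r by apply: contraNneq pns => ->; rewrite inE eqxx.
have [cadj [e [f [ef eE fE cedge]]]] := contract_cross pa qa ra pr pqa qra.
have [||ps es cs hs] := IH s r _ ra la us rs; first exact: ltnW.
  by apply: contraNN Ha => H; case: ifP => _; case: ifP => _ /=; rewrite ?inE H ?orbT.
rewrite ra /= cadj ps /= cedge es.
have e2 : e.2 by rewrite eE.
have f2 : f.2 by rewrite fE.
have ea : e.1.1 != a by rewrite eE.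
have fa : f.1.1 == a by rewrite fE.
have chE d : changes (d :: true :: map edge_dir
      (map contract_edge [seq e <- pairmap gedge_of r s | e.1.1 != a])) =
  changes (d :: true :: true :: map edge_dir (pairmap gedge_of r s)).
  by rewrite !changes_cons -es cs.
have mem y : ((a, y), true) \in pairmap gedge_of r s ->
    ((a - 1, y), true) \in pairmap gedge_of r s by apply: hs.
have e1 y : ((a, y), true) = e -> False by rewrite eE => -[] /esym/eqP; rewrite (negbTE pred_neq).
have f1 y : ((a, y), true) = f -> ((a - 1, y), true) = e by rewrite eE fE => -[->].
case: ef => -[-> ->]; rewrite ea fa /=; split=> // [d|y].
- by move: (chE d); rewrite /edge_dir /= e2 f2.
- by rewrite !inE => /or3P[/eqP/e1//|/eqP/f1 ->|/mem ->]; rewrite ?eqxx ?orbT.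
- by move: (chE d); rewrite /edge_dir /= e2 f2.
by rewrite !inE => /or3P[/eqP/f1 ->|/eqP/e1//|/mem ->]; rewrite ?eqxx ?orbT.
Qed.

End Contract.

Section ContractRep.
Variable a : int.

Lemma walk_cols_free W : is_walk W -> a \notin walk_cols W ->
  [/\ is_walk (contract_walk a W),
      walk_edges (contract_walk a W) =
        [seq contract_edge a e | e <- walk_edges W & e.1.1 != a],
      changes (map edge_dir (walk_edges (contract_walk a W))) <=
      changes (map edge_dir (walk_edges W)) &
      forall e, e \in walk_edges W -> e.1.1 = a ->
        ((a - 1, e.1.2)%R, true) \in walk_edges W].
Proof.
case: W => p s /and3P[/= s0 /andP[ps us] pth].
rewrite !inE /= !negb_or eq_sym => /and3P[pa]; rewrite eq_sym => la Ha.
have [|gp E ch H] := contract_walkP pa la _ pth Ha; first by rewrite /= ps.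
split=> //.
- apply/and3P; split=> //=.
    have ls : last p s \in s by case: (s) s0 => //= q s' _; rewrite mem_last.
    rewrite -size_eq0 size_map size_eq0 -has_filter; apply/hasP.
    by exists (last p s).
  rewrite -[_ && _]/(uniq (map (contract_pt a) (p :: [seq p <- s | p.1 != a]))).
  rewrite map_inj_in_uniq /= ?filter_uniq ?andbT //; first by rewrite mem_filter pa.
  move=> q r; rewrite !inE !mem_filter => qa ra; apply: contract_pt_inj; rewrite inE.
    by case/predU1P: qa => [->|/andP[]].
  by case/predU1P: ra => [->|/andP[]].
(* Take for [d] the first direction of the original walk: it adds no change there, and in front of
   the contracted walk it can only add some. *)
- move: ch; case: (map edge_dir (walk_edges (p, s))) => [|b l].
    move/(_ true); rewrite [RHS](_ : _ = 0) //; case: (map _ _) => // b l.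
    by rewrite changes_cons [X in _ <= X](_ : _ = 0) //; lia.
  move/(_ b); rewrite [RHS]changes_cons eqxx add0n => <-.
  by case: (map _ _) => // b' l'; rewrite changes_cons leq_addl.
move=> [[x y] d] /= eW xa; subst x; apply: H; case: d eW => // eW.
by case/mapP: Ha; exists (a, y, false) => //; rewrite mem_filter.
Qed.

Lemma walk_rep_contract k n (adj : 'I_n -> 'I_n -> bool) (W : 'I_n -> walk) :
  walk_rep k adj W -> (forall v, a \notin walk_cols (W v)) ->
  walk_rep k adj (fun v => contract_walk a (W v)).
Proof.
move=> rW Wa; have [Ww _ _ _] := rW.
have C v := walk_cols_free (Ww v) (Wa v).
apply: (walk_rep_transfer rW); try by move=> v; case: (C v).
(* The right half of a crossing disappears; every path using it also uses the left half, whose image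
   serves instead. *)
- move=> e; exists (contract_edge a (if e.1.1 == a then ((a - 1, e.1.2)%R, true) else e)) => v eW.
  have [_ -> _ H] := C v; apply: map_f; rewrite mem_filter.
  case: (eqVneq e.1.1 a) => [ea|->//]; rewrite H // andbT /=; lia.
move=> e; exists (expand_edge a e) => v; have [_ -> _ _] := C v.
by case/mapP=> f; rewrite mem_filter => /andP[fa fW] ->; rewrite contract_edgeK.
Qed.

End ContractRep.

(** * Shrinking a representation to a small box *)

Lemma size_undup_cons (T : eqType) (x : T) s : size (undup (x :: s)) <= (size (undup s)).+1.
Proof. by rewrite /=; case: ifP. Qed.

(** The column is constant along a run of vertical edges, so a new column can only appear after a
    change of direction. *)
Lemma size_vertical_cols (E : seq gedge) :
  sorted (fun e f => [|| e.2, f.2 | e.1.1 == f.1.1]) E ->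
  size (undup [seq e.1.1 | e <- E & ~~ e.2]) <= (changes (map edge_dir E)).+1.
Proof.
elim: E => [|e [|f E] IH] //; first by move=> _ /=; case: ifP.
move=> srt; have /andP[ef sE] := srt; move: (IH sE).
rewrite !map_cons changes_cons -map_cons /edge_dir => {}IH.
have [e2|/negbTE e2] := boolP e.2.
  by rewrite [filter _ _]/= e2; apply: leq_trans IH _; rewrite ltnS leq_addl.
rewrite [filter _ _]/= e2 map_cons.
have [f2|/negbTE f2] := boolP f.2.
  apply: leq_trans (size_undup_cons _ _) _.
  by move: IH; rewrite /= f2.
move: ef IH; rewrite /= e2 f2 /= => /eqP ->.
by rewrite inE eqxx.
Qed.

Lemma vertical_chain p s : path gadj p s ->
  sorted (fun e f => [|| e.2, f.2 | e.1.1 == f.1.1]) (walk_edges (p, s)).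
Proof.
rewrite /walk_edges /=; elim: s p => [|q [|r s] IH] p // /andP[pq qrs].
apply/andP; split; last exact: IH qrs.
case/andP: qrs => qr _; move: pq qr; rewrite /gadj /gedge_of /=; lia.
Qed.

(** Besides the changes of direction: one for the first vertical run and one for each end of the
    walk. *)
Lemma size_walk_cols W : is_walk W ->
  size (undup (walk_cols W)) <= changes (map edge_dir (walk_edges W)) + 3.
Proof.
case: W => p s /and3P[_ _ ps]; rewrite /walk_cols addn3.
apply: leq_trans (size_undup_cons _ _) _; rewrite ltnS.
apply: leq_trans (size_undup_cons _ _) _; rewrite ltnS.
exact/size_vertical_cols/vertical_chain.
Qed.

(** Pigeonhole: the interval has [X.+1] columns, of which the walks occupy at most [n * K]. *)
Lemma free_col n K (W : 'I_n -> walk) (lo : int) X :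
  (forall v, size (undup (walk_cols (W v))) <= K) -> n * K <= X ->
  exists2 a, (lo <= a <= lo + X%:Z)%R & forall v, a \notin walk_cols (W v).
Proof.
move=> WK nX; set L := flatten [seq undup (walk_cols (W v)) | v <- enum 'I_n].
have LK : size L <= n * K.
  rewrite size_flatten /shape -map_comp sumnE big_map big_enum /=.
  by apply: leq_trans (leq_sum _ (fun v _ => WK v)) _; rewrite sum_nat_const card_ord.
pose C := [seq (lo + i%:Z)%R | i <- iota 0 X.+1].
have uC : uniq C by rewrite map_inj_uniq ?iota_uniq // => i j; lia.
have [/allP CL|/allPn[a]] := boolP (all (mem L) C).
  have := leq_trans (uniq_leq_size uC CL) (leq_trans LK nX).
  by rewrite size_map size_iota ltnn.
case/mapP => i; rewrite mem_iota => /andP[_ iX] aE aL; exists a; first lia.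
move=> v; apply: contraNN aL => av; apply/flattenP; exists (undup (walk_cols (W v))).
  by apply: map_f; rewrite mem_enum.
by rewrite mem_undup.
Qed.

Definition in_box (P : pred gpoint) (W : walk) : bool := all P (W.1 :: W.2).

(** [Y] carries along a bound on the rows, which contracting columns leaves alone. So the pass made
    after transposition keeps the gain of the first. *)
Lemma shrink_cols k n (adj : 'I_n -> 'I_n -> bool) (Y : pred int) (lo : int) X (W : 'I_n -> walk) :
  walk_rep k adj W ->
  (forall v, in_box (fun p => (lo <= p.1 <= lo + X%:Z)%R && Y p.2) (W v)) ->
  exists2 W', walk_rep k adj W' &
  forall v, in_box (fun p => (lo <= p.1 <= lo + (n * (k + 3))%:Z)%R && Y p.2) (W' v).
Proof.
elim: X W => [|X IH] W rW bW.
  exists W => // v; apply: sub_all (bW v) => p /andP[pX ->]; rewrite andbT; lia.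
have [Xs|Xl] := leqP X.+1 (n * (k + 3)).
  exists W => // v; apply: sub_all (bW v) => p /andP[pX ->]; rewrite andbT; lia.
have [Ww Wk _ _] := rW.
have WK v : size (undup (walk_cols (W v))) <= k + 3.
  by apply: leq_trans (size_walk_cols (Ww v)) _; rewrite leq_add2r.
have [a aX aW] := free_col lo WK (ltnW Xl).
apply: IH (walk_rep_contract rW aW) _ => v.
move: (bW v) (aW v); case: (W v) => p s.
have cP q : q.1 != a -> (lo <= q.1 <= lo + X.+1%:Z)%R && Y q.2 ->
    (lo <= (contract_pt a q).1 <= lo + X%:Z)%R && Y (contract_pt a q).2.
  by case: q => x y /= xa /andP[xX ->]; rewrite andbT /contract_coord; case: ifP; lia.
rewrite /in_box /walk_cols inE negb_or /= => /andP[bp bs] /andP[pa _]; apply/andP; split.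
  by apply: cP => //; rewrite eq_sym.
rewrite all_map all_filter; apply: sub_all bs => q bq; apply/implyP => qa.
exact: cP.
Qed.

Lemma in_box_swap (P : pred gpoint) W :
  in_box P (swap_walk W) = in_box (fun p => P (swap_pt p)) W.
Proof. by case: W => p s; rewrite /in_box /= all_map. Qed.

Lemma Helly_small_rep k n (adj : 'I_n -> 'I_n -> bool) :
  has_Helly_Bk_EPG k adj -> exists (lx ly : int) (W : 'I_n -> walk),
  walk_rep k adj W /\ forall v, in_box (fun p =>
     (lx <= p.1 <= lx + (n * (k + 3))%:Z)%R && (ly <= p.2 <= ly + (n * (k + 3))%:Z)%R) (W v).
Proof.
move=> /Helly_walk_rep[W rW].
have bnd (s : seq gpoint) : exists Z : nat,
    all (fun p => (`|p.1| <= Z%:Z)%R && (`|p.2| <= Z%:Z)%R) s.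
  elim: s => [|[x y] s [Z HZ]]; first by exists 0.
  exists (maxn Z (maxn `|x| `|y|)); rewrite /=; apply/andP; split.
    lia.
  by apply: sub_all HZ => -[x' y'] /=; lia.
have [Z HZ] := bnd (flatten [seq (W v).1 :: (W v).2 | v <- enum 'I_n]).
have bZ v : in_box (fun p => ((- Z%:Z <= p.1 <= - Z%:Z + (2 * Z)%:Z) &&
                              (- Z%:Z <= p.2 <= - Z%:Z + (2 * Z)%:Z))%R) (W v).
  apply/allP => p pW; suff /(allP HZ) : p \in flatten [seq (W v).1 :: (W v).2 | v <- enum 'I_n].
    by case: (p) => x y /=; lia.
  apply/flattenP; exists ((W v).1 :: (W v).2) => //.
  by apply: (map_f (fun v => (W v).1 :: (W v).2)); rewrite mem_enum.
have [W1 r1 b1] := shrink_cols (Y := fun y => (- Z%:Z <= y <= - Z%:Z + (2 * Z)%:Z)%R) rW bZ.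
have r2 := walk_rep_swap r1.
have b2 v : in_box (fun p => ((- Z%:Z <= p.1 <= - Z%:Z + (2 * Z)%:Z) &&
    (- Z%:Z <= p.2 <= - Z%:Z + (n * (k + 3))%:Z))%R) (swap_walk (W1 v)).
  by rewrite in_box_swap; apply: sub_all (b1 v) => p /andP[pY pX]; rewrite /= pX pY.
have [W3 r3 b3] :=
  shrink_cols (Y := fun y => (- Z%:Z <= y <= - Z%:Z + (n * (k + 3))%:Z)%R) r2 b2.
(* The picture stays transposed, which does no harm since the bound is the same for both
   coordinates. *)
by exists (- Z%:Z)%R, (- Z%:Z)%R, W3.
Qed.

(** * Tables describing Helly representations *)

Definition two_of (a b c : bool) : bool := [|| a && b, a && c | b && c].

(* Gilmore's criterion: it suffices to consider, for any three edges, the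
   paths through at least two of them. *)
Lemma Helly_of_triples n (A : 'I_n -> seq gedge) :
  (forall e1 e2 e3, (exists v, e1 \in A v) -> (exists v, e2 \in A v) ->
    (exists v, e3 \in A v) ->
    exists e, forall v, two_of (e1 \in A v) (e2 \in A v) (e3 \in A v) -> e \in A v) ->
  Helly_family A.
Proof.
move=> A3 S; have [m] := ubnP #|S|; elim: m S => // m IH S Sm SA.
have [->|[u1 u1S]] := set_0Vmem S.
  by exists (0%R, 0%R, true) => v; rewrite inE.
have [S1|[u2]] := set_0Vmem (S :\ u1).
  have [e /andP[eu _]] := SA u1 u1 u1S u1S; exists e => v vS.
  by have := in_set0 v; rewrite -S1 !inE vS andbT => /negbFE/eqP->.
rewrite !inE => /andP[u21 u2S].
have [S2|[u3]] := set_0Vmem (S :\ u1 :\ u2).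
  have [e /andP[eu eu']] := SA u1 u2 u1S u2S; exists e => v vS.
  have := in_set0 v; rewrite -S2 !inE vS andbT => /negbT.
  by rewrite negb_and !negbK => /orP[]/eqP->.
rewrite !inE => /and3P[u32 u31 u3S].
(* Each [S :\ u] has a common edge by induction. A member of [S] differs from at least two of [u1],
   [u2], [u3], hence lies on at least two of the three edges obtained. *)
have del u : u \in S -> exists e, forall v, v \in S :\ u -> e \in A v.
  move=> uS; apply: IH => [|v v']; first by move: Sm; rewrite (cardsD1 u) uS.
  by rewrite !inE => /andP[_ vS] /andP[_ vS']; apply: SA.
have [e1 H1] := del _ u1S; have [e2 H2] := del _ u2S; have [e3 H3] := del _ u3S.
have [|||e He] := A3 e1 e2 e3.
- by exists u2; apply: H1; rewrite !inE u21.
- by exists u1; apply: H2; rewrite !inE eq_sym u21.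
- by exists u1; apply: H3; rewrite !inE eq_sym u31.
exists e => v vS; apply: He; rewrite /two_of.
have h1 : v != u1 -> e1 \in A v by move=> ne; apply: H1; rewrite !inE ne.
have h2 : v != u2 -> e2 \in A v by move=> ne; apply: H2; rewrite !inE ne.
have h3 : v != u3 -> e3 \in A v by move=> ne; apply: H3; rewrite !inE ne.
have [v1|/h1 ->] := eqVneq v u1.
  by rewrite h2 ?h3 ?orbT // v1 eq_sym.
have [v2|/h2 -> //] := eqVneq v u2.
by rewrite h3 ?orbT // v2 eq_sym.
Qed.

(* [touch] in coordinates: [h] tells whether the edge at [(x, y)] is horizontal. *)
Definition touch_coord (x y : nat) (h : bool) (x' y' : nat) (h' : bool) : bool :=
  [|| (x == x') && (y == y'),
      h' && (x'.+1 == x) && (y == y'), ~~ h' && (x == x') && (y'.+1 == y),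
      h && (x.+1 == x') && (y == y'), ~~ h && (x == x') && (y.+1 == y'),
      h && ~~ h' && (x.+1 == x') && (y'.+1 == y) |
      ~~ h && h' && (x'.+1 == x) && (y.+1 == y')].

Definition edge_at (lx ly : int) (x y d : nat) : gedge :=
  ((lx + x%:Z, ly + y%:Z)%R, d != 0).

Lemma touch_edge_at lx ly x y d x' y' d' :
  touch (edge_at lx ly x y d) (edge_at lx ly x' y' d') =
  touch_coord x y (d != 0) x' y' (d' != 0).
Proof.
rewrite /touch /touch_coord /edge_at.
by case: (d != 0); case: (d' != 0); rewrite /= !inE !xpair_eqE; lia.
Qed.

Lemma edge_at_inj lx ly x y d x' y' d' : d <= 1 -> d' <= 1 ->
  (edge_at lx ly x y d == edge_at lx ly x' y' d') = [&& x == x', y == y' & d == d'].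
Proof. by rewrite /edge_at !xpair_eqE; lia. Qed.

(* [T v i x y d b]: the [i]-th edge of path [v] has lower-left end [(x, y)], it is
   horizontal iff [d != 0], and [b] bends precede it. *)
Section Table.
Variables (m n K : nat) (adj : nat -> nat -> bool).
Variable T : nat -> nat -> nat -> nat -> nat -> nat -> bool.
Notation I := 'I_m.

Definition on_path (v x y d : nat) : bool := [exists i : I, [exists b : I, T v i x y d b]].

(** All checks quantify over ['I_m], and introduce zero as a quantified [z], so as to match their
    formulas quantifier by quantifier: the formula language has variables for positions but no
    constants. *)
Definition paths_nonempty : bool :=
  [forall z : I, (z == 0 :> nat) ==> [forall v : I, (v < n) ==>
    [exists x : I, [exists y : I, [exists d : I, [exists b : I, T v z x y d b]]]]]].

Definition paths_contiguous : bool :=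
  [forall v : I, [forall i : I, [forall j : I, (i.+1 == j) ==>
    [forall x : I, [forall y : I, [forall d : I, [forall b : I, T v j x y d b ==>
     [exists x' : I, [exists y' : I, [exists d' : I, [exists b' : I, T v i x' y' d' b']]]]]]]]]]].

Definition rows_valid : bool :=
  [forall z : I, (z == 0 :> nat) ==>
  [forall v : I, [forall i : I, [forall x : I, [forall y : I, [forall d : I, [forall b : I,
    T v i x y d b ==>
    [&& (d == z :> nat) || (z.+1 == d), b <= K & (i == z :> nat) ==> (b == z :> nat)]]]]]]]].

Definition rows_compatible : bool :=
  [forall v : I, [forall i : I, [forall x : I, [forall y : I, [forall d : I, [forall b : I,
  T v i x y d b ==>
  [forall j : I, [forall x' : I, [forall y' : I, [forall d' : I, [forall b' : I,
  T v j x' y' d' b' ==>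
  [&& (i == j :> nat) ==> [&& x == x' :> nat, y == y' :> nat, d == d' :> nat & b == b' :> nat],
      (i.+1 == j) ==> [&& touch_coord x y (d != 0 :> nat) x' y' (d' != 0 :> nat),
         ~~ [&& x == x' :> nat, y == y' :> nat & d == d' :> nat] &
         ((d == d' :> nat) ==> (b == b' :> nat)) && (~~ (d == d' :> nat) ==> (b.+1 == b'))] &
      ((i < j) && ~~ (i.+1 == j)) ==> ~~ touch_coord x y (d != 0 :> nat) x' y' (d' != 0 :> nat)]
  ]]]]]]]]]]].

Definition edges_represented : bool :=
  [forall u : I, [forall v : I, ([&& u < n, v < n & ~~ (u == v :> nat)]) ==>
   (adj u v == [exists x : I, [exists y : I, [exists d : I, on_path u x y d && on_path v x y d]]])]].

Definition triples_Helly : bool :=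
  [forall x1 : I, [forall y1 : I, [forall d1 : I, [forall x2 : I, [forall y2 : I, [forall d2 : I,
  [forall x3 : I, [forall y3 : I, [forall d3 : I,
  [exists x : I, [exists y : I, [exists d : I, [forall v : I, (v < n) ==>
    two_of (on_path v x1 y1 d1) (on_path v x2 y2 d2) (on_path v x3 y3 d3) ==>
    on_path v x y d]]]]]]]]]]]]].

Definition table_ok : bool :=
  [&& paths_nonempty, paths_contiguous, rows_valid, rows_compatible, edges_represented & triples_Helly].

Section Soundness.
Hypothesis ok : table_ok.
Hypothesis nm : n < m.

(** Path lengths are not stored. The length is the first index [L] without a row, and contiguity
    makes the indices with a row exactly those below [L]. *)
Lemma table_path (v : I) : v < n -> exists E : seq gedge,
  [/\ grid_path E, bends E <= K &
      forall e, e \in E <-> exists x y d : I, on_path v x y d /\ e = edge_at 0 0 x y d].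
Proof.
move=> vn; case/and5P: ok => H1 H2 H3 H4 _.
pose R (i : nat) := (i < m) && [exists x : I, [exists y : I, [exists d : I, [exists b : I, T v i x y d b]]]].
have m0 : 0 < m by apply: leq_ltn_trans nm.
have R0 : R 0.
  rewrite /R m0 /=; move/forallP: H1 => /(_ (Ordinal m0)) /= /forallP /(_ v).
  by rewrite vn.
have RS i : R i.+1 -> R i.
  case/andP=> im /existsP[x /existsP[y /existsP[d /existsP[b t]]]].
  rewrite /R (ltnW im) /=.
  move: H2 => /forallP/(_ v)/forallP/(_ (Ordinal (ltnW im)))/forallP/(_ (Ordinal im)).
  rewrite /= eqxx /= => /forallP/(_ x)/forallP/(_ y)/forallP/(_ d)/forallP/(_ b).
  by rewrite t.
have exN : exists i, ~~ R i by exists m; rewrite /R ltnn.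
case: (ex_minnP exN) => L nRL minL.
have RL i : R i = (i < L).
  apply/idP/idP => [Ri|]; last by apply: contraTT => /minL; rewrite -leqNgt.
  rewrite ltnNge; apply: contraNN nRL; elim: i Ri => [|i IH] Ri; first by rewrite leqn0 => /eqP->.
  by rewrite leq_eqVlt => /predU1P[->//|]; rewrite ltnS; apply: IH; apply: RS.
have L0 : 0 < L by rewrite -RL.
have Lm : L <= m by case: (L) RL => // L' /(_ L'); rewrite ltnSn => /andP[].
pose t (i : nat) := odflt (0, 0, 0, 0) (omap (fun q : I * I * I * I =>
    (q.1.1.1 : nat, q.1.1.2 : nat, q.1.2 : nat, q.2 : nat))
  [pick q : I * I * I * I | T v i q.1.1.1 q.1.1.2 q.1.2 q.2]).
pose px i := (t i).1.1.1; pose py i := (t i).1.1.2; pose pd i := (t i).1.2; pose pb i := (t i).2.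
have tP i : i < L -> exists x y d b : I, T v i x y d b /\ [/\ px i = x, py i = y, pd i = d & pb i = b].
  rewrite -RL => /andP[im /existsP[x /existsP[y /existsP[d /existsP[b Hi]]]]].
  rewrite /px /py /pd /pb /t; case: pickP => [[[[x' y'] d'] b'] /= H|/(_ (x, y, d, b))/=]; last by rewrite Hi.
  by exists x', y', d', b'.
have valid i : i < L -> [/\ pd i <= 1, pb i <= K & i = 0 -> pb i = 0].
  move=> iL; have [x [y [d [b [Hi [_ _ -> ->]]]]]] := tP i iL.
  have im : i < m by apply: leq_trans Lm.
  move: H3 => /forallP/(_ (Ordinal m0))/implyP/(_ (eqxx _))/forallP/(_ v)/forallP/(_ (Ordinal im)).
  move=> /forallP/(_ x)/forallP/(_ y)/forallP/(_ d)/forallP/(_ b) /=.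
  by rewrite Hi /= => /and3P[dz -> ib]; split=> // [|i0]; [lia | apply/eqP; apply: (implyP ib); apply/eqP].
have comp i j : i < L -> j < L ->
  [/\ i.+1 = j -> [/\ touch_coord (px i) (py i) (pd i != 0) (px j) (py j) (pd j != 0),
         ~~ [&& px i == px j, py i == py j & pd i == pd j] &
         pb j = (pd i != pd j) + pb i] &
      i.+1 < j -> ~~ touch_coord (px i) (py i) (pd i != 0) (px j) (py j) (pd j != 0)].
  move=> iL jL; have [x [y [d [b [Hi [-> -> -> ->]]]]]] := tP i iL.
  have [x' [y' [d' [b' [Hj [-> -> -> ->]]]]]] := tP j jL.
  have im : i < m by apply: leq_trans Lm.
  have jm : j < m by apply: leq_trans Lm.
  move: H4 => /forallP/(_ v)/forallP/(_ (Ordinal im)).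
  move=> /forallP/(_ x)/forallP/(_ y)/forallP/(_ d)/forallP/(_ b) /=; rewrite Hi /=.
  move=> /forallP/(_ (Ordinal jm)) /=.
  move=> /forallP/(_ x')/forallP/(_ y')/forallP/(_ d')/forallP/(_ b') /=; rewrite Hj /=.
  case/and3P=> _ /implyP A /implyP B; split=> [ij|ij].
    have [/eqP/A/and3P[-> -> C]] := ij; split=> //; move: C.
    by case: (d == d' :> nat) => /= [/andP[/eqP -> _]|/eqP <-].
  by apply: B; rewrite (ltnW ij) (ltn_eqF ij).
pose E := mkseq (fun i => edge_at 0 0 (px i) (py i) (pd i)) L.
exists E; have sE : size E = L by rewrite size_mkseq.
split.
- apply/grid_pathP; rewrite sE; split=> // [i iL|i j ij jL].
    have iL' := ltnW iL; rewrite !nth_mkseq // touch_edge_at.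
    have [di _ _] := valid i iL'; have [dj _ _] := valid i.+1 iL.
    by have [/(_ erefl)[-> ne _] _] := comp i i.+1 iL' iL; rewrite edge_at_inj.
  have iL : i < L by apply: ltn_trans (ltnW ij) jL.
  rewrite !nth_mkseq // touch_edge_at.
  by have [_ /(_ ij)] := comp i j iL jL.
(* The stored counters start at 0 and grow by one at each bend, so the last of them is the number of
   bends and its check against [K] bounds them all. *)
- have pre i : i < L -> \sum_(j < i) (pd j != pd j.+1) = pb i.
    elim: i => [|i IH] iL; first by have [_ _ ->] := valid 0 iL; rewrite // big_ord0.
    rewrite big_ord_recr /= IH 1?ltnW //.
    by have [/(_ erefl)[_ _ ->] _] := comp i i.+1 (ltnW iL) iL; rewrite addnC.
  have LE : L.-1 < L by rewrite prednK.
  have [_ bK _] := valid _ LE; apply: leq_trans bK; rewrite -pre // /bends sE.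
  apply/eq_leq/eq_bigr => i _; have iL : i.+1 < L by have := ltn_ord i; lia.
  have iL' := ltnW iL; rewrite !nth_mkseq // /edge_dir /=.
  have [di _ _] := valid i iL'; have [dj _ _] := valid i.+1 iL.
  by lia.
move=> e; split=> [/mapP[i]|[x [y [d [/existsP[i /existsP[b Hi]] ->]]]]].
  rewrite mem_iota => /andP[_ iL] ->; have [x [y [d [b [Hi [-> -> -> _]]]]]] := tP i iL.
  exists x, y, d; split=> //; apply/existsP; exists (Ordinal (leq_trans iL Lm)).
  by apply/existsP; exists b.
have iL : i < L.
  rewrite -RL /R ltn_ord; apply/existsP; exists x; apply/existsP; exists y.
  by apply/existsP; exists d; apply/existsP; exists b.
apply/mapP; exists (i : nat); first by rewrite mem_iota.
have [x' [y' [d' [b' [Hi' [-> -> -> _]]]]]] := tP i iL.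
(* Rows with the same path and index agree, so this row is the one picked by [t]. *)
move: H4 => /forallP/(_ v)/forallP/(_ i).
move=> /forallP/(_ x)/forallP/(_ y)/forallP/(_ d)/forallP/(_ b) /=; rewrite Hi /=.
move=> /forallP/(_ i) /=.
move=> /forallP/(_ x')/forallP/(_ y')/forallP/(_ d')/forallP/(_ b') /=; rewrite Hi' /= eqxx.
by case/andP=> /and4P[/eqP-> /eqP-> /eqP-> _].
Qed.

Lemma table_sound : has_Helly_Bk_EPG K (fun i j : 'I_n => adj i j).
Proof.
pose up (v : 'I_n) : I := widen_ord (ltnW nm) v.
have [P HP] := fin_all_exists (fun v : 'I_n => @table_path (up v) (ltn_ord v)).
exists P; case/and5P: ok => _ _ /forallP H3 _ /andP[H5 H6].
have m0 : 0 < m by apply: leq_ltn_trans nm.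
(* [edge_at] reads every nonzero [d] as horizontal, so an edge determines its coordinates only under
   [d <= 1]. *)
have d1 v (x y d : I) : on_path (v : 'I_n) x y d -> d <= 1.
  case/existsP=> i /existsP[b t].
  move: (H3 (Ordinal m0)) => /implyP/(_ (eqxx _))/forallP/(_ (up v))/forallP/(_ i).
  move=> /forallP/(_ x)/forallP/(_ y)/forallP/(_ d)/forallP/(_ b) /=.
  by rewrite t /= => /and3P[+ _ _]; lia.
have mem (v : 'I_n) (x y d : I) : d <= 1 -> (edge_at 0 0 x y d \in P v) = on_path v x y d.
  move=> dd; have [_ _ H] := HP v; apply/idP/idP => [/H[x' [y' [d' [o]]]]|o]; last by apply/H; exists x, y, d.
  move/eqP; rewrite edge_at_inj ?(d1 v x' y' d') // => /and3P[/eqP xx /eqP yy /eqP dd'].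
  by rewrite xx yy dd'.
split.
  split; last by move=> v; have [] := HP v.
  split=> [v|u v uv]; first by have [] := HP v.
  move: H5 => /forallP/(_ (up u))/forallP/(_ (up v)) /=.
  rewrite !ltn_ord /= val_eqE uv /= => /eqP ->; split.
    case/existsP=> x /existsP[y /existsP[d /andP[ou ov]]]; exists (edge_at 0 0 x y d).
    by rewrite !mem ?ou ?ov //; apply: d1 ou.
  case=> e /andP[]; have [_ _ H] := HP u; case/H=> x [y [d [ou ->]]].
  rewrite mem ?(d1 u x y d) // => ov.
  by apply/existsP; exists x; apply/existsP; exists y; apply/existsP; exists d; rewrite ou.
apply: Helly_of_triples => e1 e2 e3 [v1 e1P] [v2 e2P] [v3 e3P].
have [_ _ E1] := HP v1; have [_ _ E2] := HP v2; have [_ _ E3] := HP v3.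
have [x1 [y1 [d1' [o1 ->]]]] := proj1 (E1 _) e1P.
have [x2 [y2 [d2' [o2 ->]]]] := proj1 (E2 _) e2P.
have [x3 [y3 [d3' [o3 ->]]]] := proj1 (E3 _) e3P.
move: H6 => /forallP/(_ x1)/forallP/(_ y1)/forallP/(_ d1').
move=> /forallP/(_ x2)/forallP/(_ y2)/forallP/(_ d2').
move=> /forallP/(_ x3)/forallP/(_ y3)/forallP/(_ d3').
case/existsP=> x /existsP[y /existsP[d /forallP H]].
exists (edge_at 0 0 x y d) => v t.
have o : on_path v x y d.
  move: t; rewrite !mem ?(d1 v1 x1 y1 d1') ?(d1 v2 x2 y2 d2') ?(d1 v3 x3 y3 d3') // => t.
  by have := H (up v); rewrite /= ltn_ord t.
by rewrite mem ?(d1 v x y d).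
Qed.

End Soundness.
End Table.

(** * Tables of representations in a small box *)

Definition box_side (n K : nat) : nat := n * (K + 3).
(** One radix for all six entries of a row: the square counts the grid points of the box and so
    bounds coordinates and indices along a path, [n] and [K] account for vertices and bend counts,
    and 2 for directions. *)
Definition table_base (n K : nat) : nat := (box_side n K).+1 ^ 2 + n + K + 2.

Section Box.
Variables (lx ly : int) (M : nat).

Definition box_pt (p : gpoint) : bool :=
  ((lx <= p.1 <= lx + M%:Z) && (ly <= p.2 <= ly + M%:Z))%R.

Lemma box_ptP p : box_pt p -> exists x y : nat,
  [/\ x <= M, y <= M & p = (lx + x%:Z, ly + y%:Z)%R].
Proof.
case: p => x y /andP[/= xM yM]; exists `|x - lx|%N, `|y - ly|%N.
split; try lia; congr (_, _); lia.
Qed.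

Lemma box_edge p q : box_pt p -> box_pt q -> exists x y d : nat,
  [/\ x <= M, y <= M, d <= 1 & gedge_of p q = edge_at lx ly x y d].
Proof.
move=> /box_ptP[x [y [xM yM ->]]] /box_ptP[x' [y' [xM' yM' ->]]].
exists (minn x x'), (minn y y'), (y == y'); split; try lia.
by rewrite /gedge_of /edge_at /=; congr (_, _, _); lia.
Qed.

Lemma box_walk_edge W e : in_box box_pt W -> e \in walk_edges W -> exists x y d : nat,
  [/\ x <= M, y <= M, d <= 1 & e = edge_at lx ly x y d].
Proof.
case: W => p s; rewrite /in_box /walk_edges /=.
elim: s p => //= q s IH p /and3P[bp bq bs]; rewrite inE => /predU1P[->|]; first exact: box_edge.
by apply: IH; rewrite bq bs.
Qed.

Lemma size_box_walk W : in_box box_pt W -> is_walk W -> size (walk_edges W) <= M.+1 ^ 2.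
Proof.
case: W => p s bW /and3P[_ uW _]; rewrite size_pairmap; apply: ltnW.
pose B := [seq ((lx + i%:Z)%R, (ly + j%:Z)%R) | i <- iota 0 M.+1, j <- iota 0 M.+1].
have -> : M.+1 ^ 2 = size B by rewrite size_allpairs size_iota.
apply: (uniq_leq_size uW) => q /(allP bW) /box_ptP[x [y [xM yM ->]]].
by apply/allpairsP; exists (x, y); rewrite !mem_iota.
Qed.

End Box.

Section Completeness.
Variables (n K : nat) (adj : nat -> nat -> bool).
Variables (E : 'I_n -> seq gedge) (lx ly : int).
Notation M := (box_side n K).
Notation D := (table_base n K).
Hypothesis gpE : forall u, grid_path (E u).
Hypothesis bK : forall u, bends (E u) <= K.
Hypothesis szE : forall u, size (E u) <= M.+1 ^ 2.
Hypothesis boxE : forall u e, e \in E u -> exists x y d : nat,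
  [/\ x <= M, y <= M, d <= 1 & e = edge_at lx ly x y d].
Hypothesis adjE : forall u v : 'I_n, u != v ->
  (adj u v <-> exists e, (e \in E u) && (e \in E v)).
Hypothesis HE : Helly_family E.

Let e0 : gedge := (0%R, 0%R, true).
Definition bend_count (u : 'I_n) (i : nat) : nat :=
  \sum_(j < i) (edge_dir (nth e0 (E u) j) != edge_dir (nth e0 (E u) j.+1)).

Lemma bend_countS u i : bend_count u i.+1 =
  bend_count u i + (edge_dir (nth e0 (E u) i) != edge_dir (nth e0 (E u) i.+1)).
Proof. by rewrite /bend_count big_ord_recr. Qed.

Definition path_table (v i x y d b : nat) : bool :=
  [exists u : 'I_n, [&& u == v :> nat, i < size (E u), nth e0 (E u) i == edge_at lx ly x y d,
     d <= 1 & b == bend_count u i]].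

Lemma path_tableP (u : 'I_n) i x y d b :
  reflect [/\ i < size (E u), nth e0 (E u) i = edge_at lx ly x y d, d <= 1 & b = bend_count u i]
    (path_table u i x y d b).
Proof.
apply: (iffP existsP) => [[u' /and5P[/eqP/val_inj -> iE /eqP eE d1 /eqP bE]]|[iE eE d1 bE]].
  by split.
by exists u; rewrite iE eE bE d1 !eqxx.
Qed.

Lemma path_table_row v i x y d b : path_table v i x y d b ->
  exists2 u : 'I_n, v = u & path_table u i x y d b.
Proof.
by move=> t; have /existsP[u /and5P[/eqP uv _ _ _ _]] := t; exists u; rewrite // uv.
Qed.

Lemma bend_count_le u i : i < size (E u) -> bend_count u i <= K.
Proof.
move=> iE; apply: leq_trans (bK u); rewrite /bends /bend_count.
have le : i <= (size (E u)).-1 by rewrite -ltnS prednK // (leq_ltn_trans _ iE).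
by rewrite -(subnKC le) big_split_ord leq_addr.
Qed.

Lemma path_table_lt v i x y d b : path_table v i x y d b ->
  [/\ v < D, i < D, x < D, y < D & d < D /\ b < D].
Proof.
case/path_table_row=> u -> /path_tableP[iE eE d1 ->].
have := ltn_ord u; have := szE u; have := bend_count_le iE.
have [x' [y' [d' [xM yM d1' eE']]]] := boxE (mem_nth e0 iE).
move: eE' => /eqP; rewrite eE edge_at_inj // => /and3P[/eqP-> /eqP-> _].
have : M <= M.+1 ^ 2 by rewrite expnS expn1 -[X in X <= _]muln1 leq_mul.
rewrite /table_base; move: (_ ^ 2) (size _) iE => Z s *; split; last split; lia.
Qed.

Lemma path_table_ex (u : 'I_n) i : i < size (E u) -> exists x y d : nat,
  path_table u i x y d (bend_count u i).
Proof.
move=> iE; have [x [y [d [xM yM d1 eE]]]] := boxE (mem_nth e0 iE).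
by exists x, y, d; apply/path_tableP.
Qed.

Variable m : nat.
Hypothesis Dm : D <= m.

Lemma path_table_exI (u : 'I_n) i : i < size (E u) ->
  [exists x : 'I_m, [exists y : 'I_m, [exists d : 'I_m, [exists b : 'I_m, path_table u i x y d b]]]].
Proof.
move=> iE; have [x [y [d t]]] := path_table_ex iE.
have [_ _ xD yD [dD bD]] := path_table_lt t.
apply/existsP; exists (Ordinal (leq_trans xD Dm)).
apply/existsP; exists (Ordinal (leq_trans yD Dm)).
apply/existsP; exists (Ordinal (leq_trans dD Dm)).
by apply/existsP; exists (Ordinal (leq_trans bD Dm)).
Qed.

Lemma on_path_table (u : 'I_n) x y d :
  on_path m path_table u x y d = (d <= 1) && (edge_at lx ly x y d \in E u).
Proof.
apply/existsP/andP => [[i /existsP[b /path_tableP[iE <- d1 _]]]|[d1 /(nthP e0)[i iE eE]]].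
  by rewrite mem_nth.
have t : path_table u i x y d (bend_count u i) by apply/path_tableP.
have [_ iD _ _ [_ bD]] := path_table_lt t.
by exists (Ordinal (leq_trans iD Dm)); apply/existsP; exists (Ordinal (leq_trans bD Dm)).
Qed.

Lemma common_edge_coord (u v : 'I_n) :
  (exists e, (e \in E u) && (e \in E v)) <->
  [exists x : 'I_m, [exists y : 'I_m, [exists d : 'I_m,
     on_path m path_table u x y d && on_path m path_table v x y d]]].
Proof.
split=> [[e /andP[eu ev]]|/existsP[x /existsP[y /existsP[d]]]]; last first.
  by rewrite !on_path_table => /andP[/andP[_ eu] /andP[_ ev]]; exists (edge_at lx ly x y d); rewrite eu.
have [i iE eE] := nthP e0 eu; have [x [y [d t]]] := path_table_ex iE.
have [_ _ xD yD [dD _]] := path_table_lt t.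
apply/existsP; exists (Ordinal (leq_trans xD Dm)).
apply/existsP; exists (Ordinal (leq_trans yD Dm)).
apply/existsP; exists (Ordinal (leq_trans dD Dm)).
have /path_tableP[_ e1 d1 _] := t.
by rewrite !on_path_table /= d1 -e1 eE eu ev.
Qed.

(** [m] may be any number from [D] on, since it will be the number of positions of the whole
    word. *)
Lemma table_complete : table_ok m n K adj path_table.
Proof.
have gp u := proj1 (grid_pathP (E u)) (gpE u).
rewrite /table_ok; apply/and5P; split; [| | | |apply/andP; split].
- apply/forallP=> z; apply/implyP=> /eqP z0; apply/forallP=> v; apply/implyP=> vn.
  by rewrite z0; apply: (@path_table_exI (Ordinal vn)); have [] := gp (Ordinal vn).
- do 2!apply/forallP=> ?; apply/forallP=> j; apply/implyP=> /eqP ij.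
  do 4!apply/forallP=> ?; apply/implyP=> /path_table_row[u -> /path_tableP[jE _ _ _]].
  by apply: path_table_exI; rewrite -ij in jE; apply: ltnW.
- apply/forallP=> z; apply/implyP=> /eqP z0; do 6!apply/forallP=> ?; apply/implyP.
  case/path_table_row=> u _ /path_tableP[iE _ d1 bE]; rewrite bE bend_count_le //= z0.
  apply/andP; split; first by move: d1; case: (nat_of_ord _) => [|[]].
  by apply/implyP=> /eqP ->; rewrite /bend_count big_ord0.
- apply/forallP=> v; apply/forallP=> i; apply/forallP=> x; apply/forallP=> y.
  apply/forallP=> d; apply/forallP=> b; apply/implyP=> /path_table_row[u -> /path_tableP[iE eE d1 bE]].
  apply/forallP=> j; apply/forallP=> x'; apply/forallP=> y'.
  apply/forallP=> d'; apply/forallP=> b'; apply/implyP=> /path_tableP[jE eE' d1' bE'].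
  have [_ cE nE] := gp u.
  rewrite -!(touch_edge_at lx ly) -(edge_at_inj lx ly x y x' y' d1 d1') -eE -eE'.
  apply/and3P; split; apply/implyP.
  + move=> /eqP ij; move: eE'; rewrite -ij eE bE bE' -ij eqxx andbT => /eqP.
    by rewrite edge_at_inj.
  + move=> /eqP ij; have := cE i; rewrite ij => /(_ jE)/andP[-> ->] /=.
    have -> : b' = bend_count u i.+1 :> nat by rewrite bE' ij.
    rewrite bend_countS -bE ij eE eE' /edge_dir /edge_at /=.
    case: (eqVneq (d : nat) d') => [->|ne] /=; first by rewrite eqxx /= addn0 eqxx.
    have -> : (d != 0 :> nat) != (d' != 0 :> nat) by lia.
    by rewrite /= addn1.
  by case/andP=> ij ne; apply: nE => //; rewrite ltn_neqAle ne.
- apply/forallP=> u; apply/forallP=> v; apply/implyP=> /and3P[un vn uv].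
  have := adjE (u := Ordinal un) (v := Ordinal vn) uv.
  have := common_edge_coord (Ordinal un) (Ordinal vn) => /= -> aE.
  by apply/eqP; apply/idP/idP => /aE.
apply/forallP=> x1; apply/forallP=> y1; apply/forallP=> d1.
apply/forallP=> x2; apply/forallP=> y2; apply/forallP=> d2.
apply/forallP=> x3; apply/forallP=> y3; apply/forallP=> d3.
pose S := [set v : 'I_n | two_of (on_path m path_table v x1 y1 d1)
  (on_path m path_table v x2 y2 d2) (on_path m path_table v x3 y3 d3)].
have [e eS] : exists e, forall v, v \in S -> e \in E v.
  apply: HE => u v; rewrite !inE => uS vS.
  suff [x [y [d [ou ov]]]] : exists x y d : 'I_m,
      on_path m path_table u x y d /\ on_path m path_table v x y d.
    by exists (edge_at lx ly x y d); move: ou ov; rewrite !on_path_table => /andP[_ ->] /andP[_ ->].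
  (* Two pairs among three edges have an edge in common, so any two members of [S] share one of the
     three. *)
  case/or3P: uS => /andP[a b]; case/or3P: vS => /andP[a' b'];
    by [exists x1, y1, d1 | exists x2, y2, d2 | exists x3, y3, d3].
(* For empty [S] the common edge may lie outside the box, but then any coordinates will do. *)
have [S0|[u uS]] := set_0Vmem S.
  apply/existsP; exists x1; apply/existsP; exists y1; apply/existsP; exists d1.
  apply/forallP=> v; apply/implyP=> vn; apply/implyP=> t.
  by have := in_set0 (Ordinal vn); rewrite -S0 inE t.
have [x [y [d [xM yM dd eE]]]] := boxE (eS _ uS).
have o v (vn : v < n) : two_of (on_path m path_table v x1 y1 d1)
  (on_path m path_table v x2 y2 d2) (on_path m path_table v x3 y3 d3) -> on_path m path_table v x y d.
  by move=> t; rewrite (on_path_table (Ordinal vn)) dd -eE eS // inE.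
have : on_path m path_table u x y d by rewrite on_path_table dd -eE eS.
case/existsP=> i /existsP[b t]; have [_ _ xD yD [dD bD]] := path_table_lt t.
apply/existsP; exists (Ordinal (leq_trans xD Dm)).
apply/existsP; exists (Ordinal (leq_trans yD Dm)).
apply/existsP; exists (Ordinal (leq_trans dD Dm)).
by apply/forallP=> v; apply/implyP=> vn; apply/implyP; apply: o.
Qed.

End Completeness.

Lemma table_of_Helly n K (adj : nat -> nat -> bool) :
  has_Helly_Bk_EPG K (fun i j : 'I_n => adj i j) ->
  exists T : nat -> nat -> nat -> nat -> nat -> nat -> bool,
    (forall v i x y d b, T v i x y d b ->
       [/\ v < table_base n K, i < table_base n K, x < table_base n K, y < table_base n K &
           d < table_base n K /\ b < table_base n K]) /\
    (forall m, table_base n K <= m -> table_ok m n K adj T).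
Proof.
move=> /Helly_small_rep[lx [ly [W [rW bW]]]].
have [[[gpE adjE] bK] HE] := walk_rep_Helly rW; have [Ww _ _ _] := rW.
have szE v := size_box_walk (bW v) (Ww v).
have boxE v e := @box_walk_edge lx ly (box_side n K) (W v) e (bW v).
exists (path_table (fun v => walk_edges (W v)) lx ly); split=> [v i x y d b|m Dm].
  exact: path_table_lt.
exact: (table_complete gpE bK szE boxE adjE HE Dm).
Qed.

(** * The verifying formula *)

Definition bit1 : sym := inl (Some true).

(* Variables 0, 1, 2, 3 hold [n], [k], the base of the table and the position
   of the separator throughout. *)
Definition horner_term : term :=
  let h t x := TAdd (TMul t (TVar 2)) (TVar x) in
  TAdd (TAdd (TVar 3) TOne) (h (h (h (h (h (TVar 4) 5) 6) 7) 8) 9).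

(** The offset of a row's bit in the certificate: the number with these six digits in base [D]. *)
Definition horner (D v i x y d b : nat) : nat :=
  ((((v * D + i) * D + x) * D + y) * D + d) * D + b.

Definition FRow : form :=
  FAnd (FLt 4 2) (FAnd (FLt 5 2) (FAnd (FLt 6 2) (FAnd (FLt 7 2) (FAnd (FLt 8 2)
  (FAnd (FLt 9 2) (FTermSym 10 bit1 horner_term)))))).

Definition table_bit (w : seq (option bool)) (D s v i x y d b : nat) : bool :=
  [&& v < D, i < D, x < D, y < D, d < D, b < D &
      letter w (s + 1 + horner D v i x y d b) == bit1].

Definition FTouch : form :=
  let h d := FNot (FSym lend d) in
  FOr (FAnd (FEq 0 3) (FEq 1 4))
  (FOr (FAnd (FAnd (h 5) (FSucc 3 0)) (FEq 1 4))
  (FOr (FAnd (FAnd (FNot (h 5)) (FEq 0 3)) (FSucc 4 1))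
  (FOr (FAnd (FAnd (h 2) (FSucc 0 3)) (FEq 1 4))
  (FOr (FAnd (FAnd (FNot (h 2)) (FEq 0 3)) (FSucc 1 4))
  (FOr (FAnd (FAnd (FAnd (h 2) (FNot (h 5))) (FSucc 0 3)) (FSucc 4 1))
       (FAnd (FAnd (FAnd (FNot (h 2)) (h 5)) (FSucc 3 0)) (FSucc 1 4))))))).

Definition Row v i x y d b := FCall FRow [:: 0; 1; 2; 3; v; i; x; y; d; b].
Definition OnPath v x y d :=
  FCall (FEx 8 (FEx 9 (Row 4 8 5 6 7 9))) [:: 0; 1; 2; 3; v; x; y; d].
Definition Touch x y d x' y' d' := FCall FTouch [:: x; y; d; x'; y'; d'].
(** Position 0 is the left marker, positions 1 to [n] are the unary [n], and [n + 1] is its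
    terminator; the matrix starts at [n + 2], row by row. *)
Definition Adj i j := FCall (FTermSym 10 bit1
   (TAdd (TAdd (TAdd (TAdd (TVar 0) TOne) TOne) (TMul (TVar 1) (TVar 0))) (TVar 2))) [:: 0; i; j].
Definition TwoOf f g h := FOr (FAnd f g) (FOr (FAnd f h) (FAnd g h)).

Definition FAlls (xs : seq nat) (f : form) : form := foldr FAll f xs.
Definition FExs (xs : seq nat) (f : form) : form := foldr FEx f xs.

Definition FNonempty : form :=
  FAll 4 (FImp (FSym lend 4) (FAll 5 (FImp (FLt 5 0) (FExs [:: 6; 7; 8; 9] (Row 5 4 6 7 8 9))))).

Definition FContiguous : form :=
  FAlls [:: 4; 5; 6] (FImp (FSucc 5 6) (FAlls [:: 7; 8; 9; 10]
    (FImp (Row 4 6 7 8 9 10) (FExs [:: 11; 12; 13; 14] (Row 4 5 11 12 13 14))))).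

Definition FValid : form :=
  FAll 4 (FImp (FSym lend 4) (FAlls [:: 5; 6; 7; 8; 9; 10] (FImp (Row 5 6 7 8 9 10)
    (FAnd (FOr (FEq 9 4) (FSucc 4 9)) (FAnd (FCall FLe [:: 10; 1])
      (FImp (FEq 6 4) (FEq 10 4))))))).

Definition FCompatible : form :=
  FAlls [:: 4; 5; 6; 7; 8; 9] (FImp (Row 4 5 6 7 8 9)
  (FAlls [:: 10; 11; 12; 13; 14] (FImp (Row 4 10 11 12 13 14)
  (FAnd (FImp (FEq 5 10) (FAnd (FEq 6 11) (FAnd (FEq 7 12) (FAnd (FEq 8 13) (FEq 9 14)))))
  (FAnd (FImp (FSucc 5 10) (FAnd (Touch 6 7 8 11 12 13)
          (FAnd (FNot (FAnd (FEq 6 11) (FAnd (FEq 7 12) (FEq 8 13))))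
          (FAnd (FImp (FEq 8 13) (FEq 9 14)) (FImp (FNot (FEq 8 13)) (FSucc 9 14))))))
        (FImp (FAnd (FLt 5 10) (FNot (FSucc 5 10))) (FNot (Touch 6 7 8 11 12 13)))))))).

Definition FRepresented : form :=
  FAlls [:: 4; 5] (FImp (FAnd (FLt 4 0) (FAnd (FLt 5 0) (FNot (FEq 4 5))))
    (FIff (Adj 4 5) (FExs [:: 6; 7; 8] (FAnd (OnPath 4 6 7 8) (OnPath 5 6 7 8))))).

Definition FTriples : form :=
  FAlls [:: 4; 5; 6; 7; 8; 9; 10; 11; 12] (FExs [:: 13; 14; 15] (FAll 16 (FImp (FLt 16 0)
    (FImp (TwoOf (OnPath 16 4 5 6) (OnPath 16 7 8 9) (OnPath 16 10 11 12))
       (OnPath 16 13 14 15))))).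

Definition FTableOk : form :=
  FAnd FNonempty (FAnd FContiguous (FAnd FValid (FAnd FCompatible (FAnd FRepresented FTriples)))).

Section EvalTable.
Variable w : seq (option bool).
Notation B := (size w).+1.
Notation pos := 'I_B.+1.
Implicit Types e : nat -> pos.

Lemma eval_row e : eval FRow e =
  table_bit w (e 2) (e 3) (e 4) (e 5) (e 6) (e 7) (e 8) (e 9).
Proof. by rewrite !eval_and !eval_lt eval_term_sym. Qed.

Lemma eval_Row v i x y d b e : eval (Row v i x y d b) e =
  table_bit w (e 2) (e 3) (e v) (e i) (e x) (e y) (e d) (e b).
Proof. by rewrite eval_call eval_row. Qed.

Lemma eval_OnPath v x y d e : eval (OnPath v x y d) e =
  on_path B.+1 (table_bit w (e 2) (e 3)) (e v) (e x) (e y) (e d).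
Proof.
rewrite eval_call eval_ex; apply: eq_existsb => i; rewrite eval_ex; apply: eq_existsb => b.
by rewrite eval_Row.
Qed.

Lemma eval_Touch x y d x' y' d' e : eval (Touch x y d x' y' d') e =
  touch_coord (e x) (e y) (e d != 0 :> nat) (e x') (e y') (e d' != 0 :> nat).
Proof. by rewrite eval_call !evalE !letter_lend. Qed.

Definition adj_bit (n i j : nat) : bool := letter w (n + 1 + 1 + i * n + j) == bit1.

Lemma eval_Adj i j e : eval (Adj i j) e = adj_bit (e 0) (e i) (e j).
Proof. by rewrite eval_call eval_term_sym. Qed.

Lemma eval_table_ok e : eval FTableOk e =
  table_ok B.+1 (e 0) (e 1) (adj_bit (e 0)) (table_bit w (e 2) (e 3)).
Proof.
rewrite !eval_and; congr [&& _, _, _, _, _ & _].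
- rewrite eval_all; apply: eq_forallb => z; rewrite eval_imp eval_sym letter_lend; congr (_ ==> _).
  rewrite eval_all; apply: eq_forallb => v; rewrite eval_imp eval_lt; congr (_ ==> _).
  by do 4!(rewrite eval_ex; apply: eq_existsb => ?); rewrite eval_Row.
- do 3!(rewrite eval_all; apply: eq_forallb => ?); rewrite eval_imp eval_succ; congr (_ ==> _).
  do 4!(rewrite eval_all; apply: eq_forallb => ?); rewrite eval_imp eval_Row; congr (_ ==> _).
  by do 4!(rewrite eval_ex; apply: eq_existsb => ?); rewrite eval_Row.
- rewrite eval_all; apply: eq_forallb => z; rewrite eval_imp eval_sym letter_lend; congr (_ ==> _).
  do 6!(rewrite eval_all; apply: eq_forallb => ?).
  by rewrite eval_imp eval_Row !evalE eval_le.
- do 6!(rewrite eval_all; apply: eq_forallb => ?).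
  rewrite eval_imp eval_Row; congr (_ ==> _).
  do 5!(rewrite eval_all; apply: eq_forallb => ?).
  rewrite eval_imp eval_Row; congr (_ ==> _).
  by rewrite !(eval_and, eval_imp, eval_not) eval_lt !eval_Touch !evalE.
- do 2!(rewrite eval_all; apply: eq_forallb => ?).
  rewrite eval_imp !eval_and !eval_lt eval_not eval_eq; congr (_ ==> _).
  rewrite eval_iff eval_Adj; congr (_ == _).
  do 3!(rewrite eval_ex; apply: eq_existsb => ?).
  by rewrite eval_and !eval_OnPath.
do 9!(rewrite eval_all; apply: eq_forallb => ?).
do 3!(rewrite eval_ex; apply: eq_existsb => ?).
rewrite eval_all; apply: eq_forallb => v.
by rewrite eval_imp eval_lt eval_imp /TwoOf eval_or eval_or !eval_and !eval_OnPath.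
Qed.

End EvalTable.

(** * Parsing the encoded graph and bound *)

Definition matrix_end_term : term :=
  TAdd (TAdd (TAdd (TMul (TVar 0) (TVar 0)) (TVar 0)) TOne) TOne.

(* Variable 4 is the number of binary digits of [k]. *)
Definition FLength : form :=
  FOr (FAnd (FSym lend 1) (FSym lend 4))
      (FEx 6 (FEx 7 (FAnd (FTerm 8 TOne 6) (FAnd (FSucc 7 4) (FCall FDivPow2 [:: 1; 7; 6]))))).

Definition FDigits : form :=
  FAll 5 (FImp (FLt 5 4) (FEx 6 (FAnd (FCall FDivPow2 [:: 1; 5; 6])
    (FIff (FCall FOdd [:: 6]) (FTermSym 7 bit1 (TAdd matrix_end_term (TVar 5))))))).

Fixpoint pow_term (c : nat) : term := if c is c'.+1 then TMul (TVar 0) (pow_term c') else TOne.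

Definition FSimple : form :=
  FAll 4 (FImp (FLt 4 0) (FAnd (FNot (Adj 4 4)) (FAll 5 (FImp (FLt 5 0) (FIff (Adj 4 5) (Adj 5 4)))))).

Definition FParse : form :=
  FAnd (FSym (inl None) 3)
  (FAnd (FAll 4 (FImp (FLt 4 0) (FTermSym 5 bit1 (TAdd (TVar 4) TOne))))
  (FAnd (FTermSym 5 (inl (Some false)) (TAdd (TVar 0) TOne))
        (FEx 4 (FAnd (FTerm 5 (TAdd matrix_end_term (TVar 4)) 3) (FAnd FLength FDigits))))).

Definition FBound (c : nat) : form :=
  FEx 4 (FAnd (FTerm 5 (pow_term c) 4) (FCall FLe [:: 1; 4])).

(** Variable 1 is kept off the last position because parity and halving of [k] are exact only below
    it. *)
Definition Phi (c : nat) : form :=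
  FExs [:: 0; 1; 2; 3] (FAnd (FNot (FSym rend 1))
    (FAnd FParse (FAnd (FBound c) (FAnd FSimple FTableOk)))).

Section EvalParse.
Variable w : seq (option bool).
Notation B := (size w).+1.
Notation pos := 'I_B.+1.
Implicit Types e : nat -> pos.

Definition length_ok (K L : nat) : bool :=
  ((K == 0) && (L == 0)) || [exists j : pos, (j.+1 == L) && (K %/ 2 ^ j == 1)].

Lemma eval_length e : e 1 < B -> eval FLength e = length_ok (e 1) (e 4).
Proof.
move=> KB; rewrite eval_or eval_and !eval_sym !letter_lend; congr (_ || _).
rewrite eval_ex; apply/existsP/existsP => [[u]|[j /andP[jL Kj]]].
  rewrite eval_ex => /existsP[j].
  rewrite !eval_and eval_term // eval_succ eval_call eval_divpow2 //=.
  rewrite /upd /= (minn_idPl _) // => /and3P[/eqP <- jL Kj].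
  by exists j; rewrite jL.
exists (inord 1); rewrite eval_ex; apply/existsP; exists j.
rewrite !eval_and eval_term // eval_succ eval_call eval_divpow2 //= /upd /=.
by rewrite (minn_idPl _) // inordK // eqxx jL.
Qed.

Definition matrix_end (n : nat) : nat := n * n + n + 1 + 1.

Definition digits_ok (n K L : nat) : bool :=
  [forall i : pos, (i < L) ==> [exists q : pos, (K %/ 2 ^ i == q) &&
     (odd q == (letter w (matrix_end n + i) == bit1))]].

Lemma eval_digits e : e 1 < B -> eval FDigits e = digits_ok (e 0) (e 1) (e 4).
Proof.
move=> KB; rewrite eval_all; apply: eq_forallb => i.
rewrite eval_imp eval_lt; congr (_ ==> _); rewrite eval_ex; apply: eq_existsb => q.
rewrite eval_and eval_call eval_divpow2 // /upd /=.
case: eqP => //= Kq; have qB : q < B by rewrite -Kq (leq_ltn_trans (leq_div _ _)).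
by rewrite eval_iff eval_call eval_odd ?eval_term_sym.
Qed.

Definition parse_ok (n K s : nat) : bool :=
  [&& letter w s == inl None,
      [forall i : pos, (i < n) ==> (letter w (i + 1) == bit1)],
      letter w (n + 1) == inl (Some false) &
      [exists L : pos, [&& minn (matrix_end n + L) B == s, length_ok K L & digits_ok n K L]]].

Lemma eval_parse e : e 1 < B -> eval FParse e = parse_ok (e 0) (e 1) (e 3).
Proof.
move=> KB; rewrite !eval_and eval_sym; congr [&& _, _, _ & _].
- rewrite eval_all; apply: eq_forallb => i.
  by rewrite eval_imp eval_lt eval_term_sym.
- by rewrite eval_term_sym.
rewrite eval_ex; apply: eq_existsb => L.
by rewrite !eval_and eval_term // eval_length // eval_digits.
Qed.

Lemma pow_term_bound c : tbound 5 (pow_term c).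
Proof. by elim: c. Qed.

Lemma tval_pow c (e : nat -> nat) : tval e (pow_term c) = e 0 ^ c.
Proof. by elim: c => //= c ->; rewrite expnS. Qed.

(** [e 1] is itself at most [B], so cutting the power off at [B] does not affect the comparison. *)
Lemma eval_bound c e : eval (FBound c) e = (e 1 <= e 0 ^ c).
Proof.
rewrite eval_ex; apply/existsP/idP => [[v]|le].
  rewrite eval_and eval_term ?pow_term_bound // eval_call eval_le tval_pow /upd /=.
  by case/andP=> /eqP <-; lia.
exists (inord (minn (e 0 ^ c) B)).
rewrite eval_and eval_term ?pow_term_bound // eval_call eval_le tval_pow /upd /=.
by rewrite inordK ?eqxx /=; have := ltn_ord (e 1); lia.
Qed.

Definition simple_ok (n : nat) : bool :=
  [forall u : pos, (u < n) ==> (~~ adj_bit w n u u &&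
     [forall v : pos, (v < n) ==> (adj_bit w n u v == adj_bit w n v u)])].

Lemma eval_simple e : eval FSimple e = simple_ok (e 0).
Proof.
rewrite eval_all; apply: eq_forallb => u; rewrite eval_imp eval_lt; congr (_ ==> _).
rewrite eval_and eval_not eval_Adj; congr (_ && _).
rewrite eval_all; apply: eq_forallb => v; rewrite eval_imp eval_lt; congr (_ ==> _).
by rewrite eval_iff !eval_Adj.
Qed.

Lemma eval_body c e :
  eval (FAnd (FNot (FSym rend 1)) (FAnd FParse (FAnd (FBound c) (FAnd FSimple FTableOk)))) e =
  [&& e 1 < B, parse_ok (e 0) (e 1) (e 3), e 1 <= e 0 ^ c, simple_ok (e 0) &
      table_ok B.+1 (e 0) (e 1) (adj_bit w (e 0)) (table_bit w (e 2) (e 3))].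
Proof.
rewrite eval_and eval_not eval_sym letter_rend -leqNgt -ltnS.
case: (ltnP (e 1) B) => //= KB.
by rewrite eval_and (eval_parse KB) eval_and eval_bound eval_and eval_simple eval_table_ok.
Qed.

Lemma holds_Phi c : reflect
  (exists n K D s : pos, [/\ K < B, parse_ok n K s, K <= n ^ c, simple_ok n &
     table_ok B.+1 n K (adj_bit w n) (table_bit w D s)])
  (holds w (Phi c)).
Proof.
have -> : holds w (Phi c) = [exists n : pos, [exists K : pos, [exists D : pos, [exists s : pos,
    [&& K < B, parse_ok n K s, K <= n ^ c, simple_ok n &
     table_ok B.+1 n K (adj_bit w n) (table_bit w D s)]]]]].
  by rewrite /holds; do 4!(rewrite eval_ex; apply: eq_existsb => ?); rewrite eval_body.
apply: (iffP existsP) => [[n /existsP[K /existsP[D /existsP[s]]]]|[n [K [D [s H]]]]].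
  by case/and5P=> KB H1 H2 H3 H4; exists n, K, D, s.
exists n; apply/existsP; exists K; apply/existsP; exists D; apply/existsP; exists s.
by apply/and5P; case: H.
Qed.

End EvalParse.

(** * Words, encodings and polynomial bounds *)

Lemma size_bin K : size (bin K) = if K == 0 then 0 else (trunc_log 2 K).+1.
Proof. by rewrite /bin; case: ifP => // _; rewrite size_map size_iota. Qed.

Lemma nth_bin K i : i < size (bin K) -> nth false (bin K) i = odd (K %/ 2 ^ i).
Proof.
rewrite size_bin /bin; case: ifP => // _ iK.
by rewrite (nth_map 0) ?size_iota // nth_iota.
Qed.

Lemma allpairs_iota (T : Type) (f : nat -> nat -> T) n k :
  [seq f i j | i <- iota 0 k, j <- iota 0 n] = mkseq (fun t => f (t %/ n) (t %% n)) (k * n).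
Proof.
elim: k => [|k IH] //; rewrite -addn1 iotaD allpairs_cat IH mulnDl mul1n /mkseq iotaD map_cat.
congr (_ ++ _); rewrite add0n /= cats0 -[in RHS](addn0 (k * n)) (iotaDl (k * n) 0) -map_comp.
apply/eq_in_map => j; rewrite mem_iota /= => jn.
by rewrite divnMDl ?modnMDl ?divn_small ?modn_small ?addn0 //; case: (n) jn.
Qed.

Lemma encodeE n (adj : nat -> nat -> bool) K :
  encode (fun i j : 'I_n => adj i j) K =
  nseq n true ++ false :: mkseq (fun t => adj (t %/ n) (t %% n)) (n * n) ++ bin K.
Proof.
rewrite /encode -allpairs_iota -val_enum_ord allpairs_mapl.
by rewrite allpairs_mapr.
Qed.

Lemma size_encode n (adj : nat -> nat -> bool) K :
  size (encode (fun i j : 'I_n => adj i j) K) = n + 1 + n * n + size (bin K).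
Proof. by rewrite encodeE size_cat size_nseq /= size_cat size_mkseq; lia. Qed.

Lemma nth_encode n (adj : nat -> nat -> bool) K t :
  nth false (encode (fun i j : 'I_n => adj i j) K) t =
  if t < n then true else if t == n then false
  else if t < n + 1 + n * n then adj ((t - (n + 1)) %/ n) ((t - (n + 1)) %% n)
  else nth false (bin K) (t - (n + 1 + n * n)).
Proof.
rewrite encodeE nth_cat size_nseq nth_nseq; case: ltnP => // nt.
case: eqP => [->|tn]; first by rewrite subnn.
have -> : t - n = (t - (n + 1)).+1 by lia.
rewrite /= nth_cat size_mkseq.
have -> : (t - (n + 1) < n * n) = (t < n + 1 + n * n) by lia.
case: ltnP => tn2; first by rewrite nth_mkseq //; lia.
by congr nth; lia.
Qed.

Section Words.
Variables x y : seq bool.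
Notation w := (pair_input x y).

Lemma size_pair_input : size w = size x + size y + 1.
Proof. by rewrite size_cat /= !size_map; lia. Qed.

Lemma letter_x t : t < size x -> letter w t.+1 = inl (Some (nth false x t)).
Proof.
move=> tx; rewrite /letter /= map_cat nth_cat !size_map tx.
by rewrite (nth_map None) ?size_map // (nth_map false).
Qed.

Lemma letter_sep : letter w (size x).+1 = inl None.
Proof. by rewrite /letter /= map_cat nth_cat !size_map ltnn subnn. Qed.

Lemma letter_y t : t < size y -> letter w (size x + 1 + 1 + t) = inl (Some (nth false y t)).
Proof.
move=> ty; rewrite /letter !addn1 !addSn /= map_cat nth_cat !size_map.
have -> : ((size x + t).+1 < size x) = false by lia.
have -> : (size x + t).+1 - size x = t.+1 by lia.
by rewrite /= (nth_map None) ?size_map // (nth_map false).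
Qed.

Lemma letter_sepP s : letter w s = inl None -> s = (size x).+1.
Proof.
case: s => [|s] // Hs; have := size_pair_input => sw.
case: (ltngtP s (size x)) => [sx|sx|-> //]; first by rewrite letter_x in Hs.
case: (ltnP s (size w)) => sw'.
  have [sy e] : s - (size x).+1 < size y /\ s.+1 = size x + 1 + 1 + (s - (size x).+1) by lia.
  by rewrite e letter_y in Hs.
by move: Hs; rewrite /letter /= nth_default // size_map.
Qed.

(** The quotient of [K] by [2 ^ j] is 1 exactly when [2 ^ j <= K < 2 ^ j.+1], so [j] is the binary
    logarithm; being smaller than [K], it is a position. *)
Lemma length_okP K L : K < (size w).+1 -> length_ok w K L = (L == size (bin K)).
Proof.
move=> KB; rewrite size_bin /length_ok; case: (posnP K) => [->|K0] /=.
  case: eqP => //= _; apply/existsP => -[j].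
  by rewrite div0n andbF.
have /andP[lo hi] := trunc_log_bounds (isT : 1 < 2) K0.
have lt : trunc_log 2 K < K by apply: leq_trans lo; apply: ltn_expl.
apply/existsP/eqP => [[j /andP[/eqP <- /eqP Kj]]|->].
  congr _.+1; apply/esym/trunc_log_eq => //; have p0 : 0 < 2 ^ j by rewrite expn_gt0.
  have := divn_eq K (2 ^ j); have := ltn_pmod K p0; rewrite Kj mul1n expnS; lia.
exists (inord (trunc_log 2 K)); rewrite inordK ?eqxx /=; last by lia.
have p0 : 0 < 2 ^ trunc_log 2 K by rewrite expn_gt0.
rewrite eqn_leq leq_divRL // mul1n lo andbT -ltnS ltn_divLR //.
by rewrite mulnC -expnSr.
Qed.

(** The matrix block may hold any bits, as they define [adj_bit]. The unary prefix, the digits of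
    [K] and the total length fix the rest of [x]. *)
Lemma parse_sound n K s : n <= (size w).+1 -> K < (size w).+1 -> parse_ok w n K s ->
  s = (size x).+1 /\ x = encode (fun i j : 'I_n => adj_bit w n i j) K.
Proof.
move=> nB KB /and4P[/eqP/letter_sepP -> /forallP Hn /eqP Hf /existsP[L /and3P[/eqP sL]]].
rewrite length_okP // => /eqP EL /forallP Hd; split=> //.
have sw := size_pair_input.
(* The separator lies before [B], so the sum locating it has not saturated. *)
have sx : size x = n + 1 + n * n + size (bin K).
  move: sL; rewrite /matrix_end EL sw; lia.
apply: (@eq_from_nth _ false); first by rewrite size_encode.
move=> t tx; rewrite nth_encode; have lx := letter_x tx.
have inj (b b' : bool) : (inl (Some b) == inl (Some b') :> sym) = (b == b') by [].
case: ltnP => [tn|nt].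
  have tB : t < (size w).+2 by lia.
  by have := Hn (Ordinal tB); rewrite /= tn /= addn1 lx inj => /eqP.
case: eqP => [tn|tn]; first by move: Hf; rewrite addn1 -tn lx => -[].
case: ltnP => tm.
  have -> : adj_bit w n ((t - (n + 1)) %/ n) ((t - (n + 1)) %% n) = (letter w t.+1 == bit1).
    by rewrite /adj_bit -addnA -divn_eq; congr (letter w _ == _); lia.
  by rewrite lx inj eqb_id.
set i := t - _; have iL : i < L by rewrite EL; lia.
have iB : i < (size w).+2 by lia.
have := Hd (Ordinal iB); rewrite /= iL /= => /existsP[q /andP[/eqP qE]].
have -> : matrix_end n + i = t.+1 by rewrite /matrix_end; lia.
by rewrite lx inj eqb_id nth_bin -?EL // qE => /eqP.
Qed.

Lemma parse_complete n K (adj : nat -> nat -> bool) :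
  x = encode (fun i j : 'I_n => adj i j) K -> K < (size w).+1 ->
  parse_ok w n K (size x).+1 /\ forall i j, i < n -> j < n -> adj_bit w n i j = adj i j.
Proof.
move=> xE KB; have sw := size_pair_input.
have sx : size x = n + 1 + n * n + size (bin K) by rewrite xE size_encode.
have inj (b b' : bool) : (inl (Some b) == inl (Some b') :> sym) = (b == b') by [].
have lx t : t < size x -> letter w t.+1 = inl (Some (nth false (encode (fun i j : 'I_n => adj i j) K) t)).
  by move=> tx; rewrite letter_x // -xE.
split; last first.
  move=> i j iN jN; have lt : i * n + j < n * n by nia.
  set t := n + 1 + (i * n + j).
  have h0 : n + 1 + 1 + i * n + j = t.+1 by rewrite /t; lia.
  have h1 : (t < n) = false by rewrite /t; lia.
  have h2 : (t == n) = false by rewrite /t; lia.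
  have h3 : t < n + 1 + n * n by rewrite /t; lia.
  have h4 : t - (n + 1) = i * n + j by rewrite /t; lia.
  rewrite /adj_bit h0 lx ?inj ?eqb_id ?nth_encode ?h1 ?h2 ?h3 ?h4; last lia.
  by rewrite divnMDl ?modnMDl ?divn_small ?modn_small ?addn0 //; lia.
apply/and4P; split.
- by rewrite letter_sep.
- apply/forallP=> i; apply/implyP=> iN; rewrite addn1 lx; last lia.
  by rewrite nth_encode iN.
- by rewrite addn1 lx ?nth_encode ?ltnn ?eqxx //; lia.
have LB : size (bin K) < (size w).+2 by lia.
apply/existsP; exists (Ordinal LB); apply/and3P; split=> /=.
- by rewrite /matrix_end; apply/eqP; lia.
- by rewrite length_okP.
apply/forallP=> i; apply/implyP=> iL; apply/existsP; exists (inord (K %/ 2 ^ i)).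
have qK := leq_div K (2 ^ i).
rewrite inordK; last lia.
set t := n + 1 + n * n + i.
have h0 : matrix_end n + i = t.+1 by rewrite /matrix_end /t; lia.
have h1 : (t < n) = false by rewrite /t; lia.
have h2 : (t == n) = false by rewrite /t; lia.
have h3 : (t < n + 1 + n * n) = false by rewrite /t; lia.
have h4 : t - (n + 1 + n * n) = i by rewrite /t; lia.
rewrite eqxx /= h0 lx ?inj ?eqb_id ?nth_encode ?h1 ?h2 ?h3 ?h4; last lia.
by rewrite nth_bin.
Qed.

End Words.

(** * Tables as certificate words *)

Lemma horner_lt D v i x y d b :
  v < D -> i < D -> x < D -> y < D -> d < D -> b < D -> horner D v i x y d b < D ^ 6.
Proof.
have step k q r : q < D ^ k -> r < D -> q * D + r < D ^ k.+1.
  move=> qk rD; apply: (@leq_trans (q.+1 * D)); first by rewrite mulSn; lia.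
  by rewrite expnSr leq_mul2r qk orbT.
by move=> vD iD xD yD dD bD; rewrite /horner; do 5!apply: (step) => //; rewrite expn1.
Qed.

Definition table_word (D : nat) (T : nat -> nat -> nat -> nat -> nat -> nat -> bool) : seq bool :=
  mkseq (fun t => T (t %/ D %/ D %/ D %/ D %/ D) (t %/ D %/ D %/ D %/ D %% D)
    (t %/ D %/ D %/ D %% D) (t %/ D %/ D %% D) (t %/ D %% D) (t %% D)) (D ^ 6).

(** An equality of functions, so that the table can be replaced inside [table_ok]. When some entry
    is not below [D], both sides are false. *)
Lemma table_bit_word (x : seq bool) D (T : nat -> nat -> nat -> nat -> nat -> nat -> bool) :
  (forall v i p q d b, T v i p q d b -> [/\ v < D, i < D, p < D, q < D & d < D /\ b < D]) ->
  table_bit (pair_input x (table_word D T)) D (size x).+1 = T.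
Proof.
move=> TD; apply: functional_extensionality => v; apply: functional_extensionality => i.
apply: functional_extensionality => p; apply: functional_extensionality => q.
apply: functional_extensionality => d; apply: functional_extensionality => b.
have word : v < D -> i < D -> p < D -> q < D -> d < D -> b < D ->
    letter (pair_input x (table_word D T)) ((size x).+1 + 1 + horner D v i p q d b) =
    inl (Some (T v i p q d b)).
  move=> vD iD pD qD dD bD; have hD := horner_lt vD iD pD qD dD bD.
  rewrite -[(size x).+1]addn1 letter_y ?size_mkseq // nth_mkseq // /horner.
  have dm k r : r < D -> ((k * D + r) %/ D = k) * ((k * D + r) %% D = r).
    move=> rD; have D0 : 0 < D by apply: leq_ltn_trans rD.
    by rewrite divnMDl // modnMDl divn_small // modn_small // addn0.
  by rewrite !dm.
apply/idP/idP => [/and5P[vD iD pD qD /and3P[dD bD]]|t].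
  by rewrite word // => /eqP[->].
have [vD iD pD qD [dD bD]] := TD _ _ _ _ _ _ t.
by rewrite /table_bit vD iD pD qD dD bD word ?t.
Qed.

(** * Polynomial bounds *)

Definition poly_bounded (g : nat -> nat) : Prop := exists a b, forall s, g s <= a * s.+1 ^ b.

Lemma poly_const c : poly_bounded (fun=> c).
Proof. by exists c, 0 => s; rewrite muln1. Qed.

Lemma poly_id : poly_bounded id.
Proof. by exists 1, 1 => s; rewrite mul1n expn1. Qed.

Lemma poly_add g h : poly_bounded g -> poly_bounded h -> poly_bounded (fun s => g s + h s).
Proof.
move=> [a [b gP]] [a' [b' hP]]; exists (a + a'), (b + b') => s.
rewrite mulnDl leq_add //.
  by apply: leq_trans (gP s) _; rewrite leq_mul2l leq_pexp2l ?orbT // leq_addr.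
by apply: leq_trans (hP s) _; rewrite leq_mul2l leq_pexp2l ?orbT // leq_addl.
Qed.

Lemma poly_mul g h : poly_bounded g -> poly_bounded h -> poly_bounded (fun s => g s * h s).
Proof.
move=> [a [b gP]] [a' [b' hP]]; exists (a * a'), (b + b') => s.
by rewrite expnD mulnACA leq_mul.
Qed.

Lemma poly_exp g k : poly_bounded g -> poly_bounded (fun s => g s ^ k).
Proof.
move=> gP; elim: k => [|k IH]; first by exists 1, 0 => s; rewrite expn0.
by have [a [b H]] := poly_mul gP IH; exists a, b => s; rewrite expnS.
Qed.

Lemma has_Helly_ext k n (adj adj' : 'I_n -> 'I_n -> bool) :
  adj =2 adj' -> has_Helly_Bk_EPG k adj -> has_Helly_Bk_EPG k adj'.
Proof.
move=> E; suff -> : adj' = adj by [].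
by do 2!(apply: functional_extensionality => ?); rewrite E.
Qed.

Lemma leq_expl m n e : m <= n -> m ^ e <= n ^ e.
Proof. by case: e => [|e] // mn; rewrite leq_exp2r. Qed.

Lemma table_base_mono n n' K K' : n <= n' -> K <= K' -> table_base n K <= table_base n' K'.
Proof.
move=> nn KK; have bb : box_side n K <= box_side n' K' by rewrite leq_mul // leq_add2r.
by rewrite /table_base !leq_add // leq_expl.
Qed.

(** The length [D ^ 6] of a table, made to depend on the input size [s] only, through [n <= s] and
    [k <= n ^ c <= s ^ c]. *)
Definition certificate_bound (c s : nat) : nat := table_base s (s ^ c) ^ 6.

Lemma poly_certificate_bound c : poly_bounded (certificate_bound c).
Proof.
have pc : poly_bounded (fun s => s ^ c) := poly_exp c poly_id.
apply: poly_exp; do 3!(apply: poly_add; last exact: poly_const || exact: pc || exact: poly_id).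
apply: (@poly_exp (fun s => (box_side s (s ^ c)).+1)).
have [a [b H]] := poly_add (poly_mul poly_id (poly_add pc (poly_const 3))) (poly_const 1).
by exists a, b => s; have := H s; rewrite addn1.
Qed.

(** * The formula characterises the language *)

Lemma Phi_sound c x y : holds (pair_input x y) (Phi c) -> HellyBkEPG_lang c x.
Proof.
case/holds_Phi=> n [K [D [s [KB pok Kc /forallP simp tok]]]].
have nB : n <= (size (pair_input x y)).+1 by rewrite -ltnS ltn_ord.
have [sE xE] := parse_sound nB KB pok.
exists n, (fun i j => adj_bit (pair_input x y) n i j), K; split=> //; last first.
  by apply: table_sound tok _; rewrite ltn_ord.
pose up (v : 'I_n) : 'I_(size (pair_input x y)).+2 := widen_ord (ltnW (ltn_ord n)) v.
split=> [u v|u].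
  have := simp (up u); rewrite /= ltn_ord /= => /andP[_ /forallP /(_ (up v))].
  by rewrite /= ltn_ord /= => /eqP.
by have := simp (up u); rewrite /= ltn_ord /= => /andP[/negbTE].
Qed.

Lemma Phi_complete c x : HellyBkEPG_lang c x ->
  exists2 y, size y <= certificate_bound c (size x) & holds (pair_input x y) (Phi c).
Proof.
case=> n [adj [K [xE [adjC adjI] Kc HH]]].
(* The table checks take adjacency as a function on all numbers, so [adj] is extended by [false]. *)
pose a i j := if insub i is Some u then if insub j is Some v then adj u v else false else false.
have aE u v : a (u : 'I_n) (v : 'I_n) = adj u v by rewrite /a !valK.
have xE' : x = encode (fun i j : 'I_n => a i j) K.
  rewrite xE; congr encode.
  by do 2!(apply: functional_extensionality => ?); rewrite aE.
have [T [TD Tok]] := table_of_Helly (has_Helly_ext (fun u v => esym (aE u v)) HH).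
set D := table_base n K in TD Tok; set y := table_word D T.
have nx : n <= size x by rewrite xE' size_encode; lia.
have sy : size y = D ^ 6 by rewrite size_mkseq.
have D0 : 0 < D by rewrite /D /table_base; lia.
(* The certificate itself makes the room: thanks to it [K] and [D] become positions of the word. *)
have Dy : D <= size y by rewrite sy -[X in X <= _]expn1 leq_pexp2l.
exists y.
  rewrite sy leq_expl // table_base_mono //; apply: leq_trans Kc _.
  exact: leq_expl.
have sw := size_pair_input x y.
have KD : K < D by rewrite /D /table_base; lia.
have KB : K < (size (pair_input x y)).+1 by lia.
have [pok adjE] := parse_complete xE' KB.
have tok : table_ok (size (pair_input x y)).+2 n K (adj_bit (pair_input x y) n)
    (table_bit (pair_input x y) D (size x).+1).
  rewrite [table_bit _ _ _]table_bit_word //.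
  have -> // : table_ok (size (pair_input x y)).+2 n K (adj_bit (pair_input x y) n) T =
     table_ok (size (pair_input x y)).+2 n K a T.
  congr [&& _, _, _, _, _ & _]; apply: eq_forallb => u; apply: eq_forallb => v.
  by case: (ltnP u n) => //= un; case: (ltnP v n) => //= vn; rewrite adjE.
  by apply: Tok; lia.
have [nw Kw Dw xw] : [/\ n < (size (pair_input x y)).+2, K < (size (pair_input x y)).+2,
    D < (size (pair_input x y)).+2 & (size x).+1 < (size (pair_input x y)).+2].
  by rewrite sw; split; lia.
apply/holds_Phi; exists (Ordinal nw), (Ordinal Kw), (Ordinal Dw), (Ordinal xw).
split; [exact: KB|exact: pok|exact: Kc| |exact: tok].
apply/forallP=> u; apply/implyP=> un; rewrite adjE //.
rewrite -[u : nat]/(nat_of_ord (Ordinal un)) aE adjI /=.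
apply/forallP=> v; apply/implyP=> vn; rewrite !adjE //.
by rewrite -[u : nat]/(nat_of_ord (Ordinal un)) -[v : nat]/(nat_of_ord (Ordinal vn)) !aE adjC.
Qed.

Theorem theorem3p2 (c : nat) : in_NP (HellyBkEPG_lang c).
Proof.
have [M [a0 [b0 MP]]] := form_machine (Phi c).
pose time s := a0 * (s + certificate_bound c s + 1).+1 ^ b0.
(* The definition of NP uses the same polynomial for certificates and for time, so their bounds are
   added. *)
have [a [b H]] : poly_bounded (fun s => certificate_bound c s + time s).
  apply: poly_add (poly_certificate_bound c) _; apply: poly_mul (poly_const _) _.
  apply: (@poly_exp (fun s => (s + certificate_bound c s + 1).+1)).
  have [a [b H]] := poly_add (poly_add poly_id (poly_certificate_bound c)) (poly_const 2).
  by exists a, b => s; have := H s; rewrite addn2 addn1.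
exists M, a, b => x; split=> [/Phi_complete[y yB hy]|[y [_ acc]]].
  exists y; split; first by apply: leq_trans yB (leq_trans (leq_addr _ _) (H _)).
  have w0 : 0 < size (pair_input x y) by rewrite size_pair_input addn1.
  apply: (proj2 (MP _ w0 _)) hy _; apply: leq_trans (H _); apply: leq_trans (leq_addl _ _).
  by rewrite leq_mul2l leq_expl ?orbT // size_pair_input ltnS leq_add2r leq_add2l.
have w0 : 0 < size (pair_input x y) by rewrite size_pair_input addn1.
by apply: Phi_sound (proj1 (MP _ w0 _) acc).
Qed.
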